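(* Let $(\mathcal A,\varphi)$ be a $W^*$-probability space and let $P,Q,P',Q'\in\mathcal A$ be hermitian projections, i.e. $P=P^*=P^2$, $Q=Q^*=Q^2$, $P'=P'^*=P'^2$, $Q'=Q'^*=Q'^2$, such that $[P,Q]=[P',Q]=[P,Q']=[P',Q']=0$ and such that the two-faced pairs $(P,Q)$ and $(P',Q')$ are bi-free in $(\mathcal A,\varphi)$. Then $$\varphi(P\wedge P')=(\varphi(P)+\varphi(P')-1)_+,\qquad \varphi(Q\wedge Q')=(\varphi(Q)+\varphi(Q')-1)_+,$$ and if $\varphi(P\wedge P')>0$, $\varphi(Q\wedge Q')>0$, $\varphi(PQ)>0$ and $\varphi(P'Q')>0$, then $$\frac{\varphi(P\wedge P')\,\varphi(Q\wedge Q')}{\varphi((P\wedge P')(Q\wedge Q'))}=\frac{\varphi(P)\varphi(Q)}{\varphi(PQ)}+\frac{\varphi(P')\varphi(Q')}{\varphi(P'Q')}-1 .$$ If any of the numbers $\varphi(P\wedge P')$, $\varphi(Q\wedge Q')$, $\varphi(PQ)$, $\varphi(P'Q')$ is $0$, then $\varphi((P\wedge P')(Q\wedge Q'))=0$.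
   Context: A $W^*$-probability space $(\mathcal A,\varphi)$ is a von Neumann algebra $\mathcal A$ with a normal state $\varphi$ (not assumed tracial or faithful). For projections $P,P'\in\mathcal A$, $P\wedge P'$ is the largest projection that is $\le P$ and $\le P'$, i.e. the orthogonal projection onto the intersection of their ranges. $[x,y]=xy-yx$ and $t_+=\max(t,0)$. Bi-freeness. A two-faced pair $(a,b)$ in $(\mathcal A,\varphi)$ is an ordered pair of elements, $a$ being the left variable and $b$ the right variable. Let $\mathcal X_i=\mathbb C\xi_i\oplus\mathcal X_i^\circ$ ($i=1,2$) be complex vector spaces with distinguished vector $\xi_i$ and complement $\mathcal X_i^\circ$. Their free product is $\mathcal X=\mathbb C\xi\oplus\mathcal X^\circ$, $\mathcal X^\circ=\bigoplus_{n\ge1}\bigoplus_{i_1\ne i_2\ne\cdots\ne i_n}\mathcal X_{i_1}^\circ\otimes\cdots\otimes\mathcal X_{i_n}^\circ$. Let $\mathcal X(\ell,i)$ (resp. $\mathcal X(r,i)$) be the sum of $\mathbb C\xi$ and of those summands with $i_1\ne i$ (resp. $i_n\ne i$). There are natural isomorphisms $V_i:\mathcal X_i\otimes\mathcal X(\ell,i)\to\mathcal X$ and $W_i:\mathcal X(r,i)\otimes\mathcal X_i\to\mathcal X$ (concatenation of tensors, with $\xi_i$ and $\xi$ acting as empty tensors). For a linear operator $T$ on $\mathcal X_i$ put $\lambda_i(T)=V_i(T\otimes I)V_i^{-1}$ and $\rho_i(T)=W_i(I\otimes T)W_i^{-1}$. For a linear operator $S$ on $\mathcal X$ let $\varphi_\xi(S)\in\mathbb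 C$ be defined by $S\xi\in\varphi_\xi(S)\xi+\mathcal X^\circ$. Two two-faced pairs $(a_1,b_1)$ and $(a_2,b_2)$ in $(\mathcal A,\varphi)$ are bi-free if there are such spaces $\mathcal X_1,\mathcal X_2$ and linear operators $A_i,B_i$ on $\mathcal X_i$ such that the joint distribution (all non-commutative moments) of $(a_1,b_1,a_2,b_2)$ with respect to $\varphi$ equals that of $(\lambda_1(A_1),\rho_1(B_1),\lambda_2(A_2),\rho_2(B_2))$ with respect to $\varphi_\xi$. *)

(* Defs.v *)
From HB Require Import structures.
From mathcomp Require Import all_boot all_order all_algebra.
From mathcomp Require Import ring_quotient generic_quotient.
From mathcomp Require Import all_classical all_reals all_analysis.
From mathcomp Require Import complex.
From mathcomp Require Import freeg.

Set Implicit Arguments.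
Unset Strict Implicit.
Unset Printing Implicit Defensive.

Import Order.TTheory GRing.Theory Num.Theory.
Import numFieldNormedType.Exports.

Local Open Scope classical_set_scope.
Local Open Scope ring_scope.
Local Open Scope quotient_scope.

(* The free product of the pointed spaces X_i = K xi_i (+) V i (the index i
   being true or false, and V i playing the role of X_i°), realized as the free
   vector space on the words x_1 ... x_n, x_k in V i_k, modulo multilinearity
   in each x_k and modulo the words with two consecutive equal labels.  Thus
   the words labelled i_1 ... i_n span V i_1 (x) ... (x) V i_n when the labels
   alternate, and the empty word is the distinguished vector. *)
Section FreeProduct.
Variables (K : fieldType) (V : bool -> lmodType K).

Local Notation letter := {i : bool & V i}.
Local Notation fwords := {freeg (seq letter) / K}.

Definition labels (w : seq letter) : seq bool := map tag w.
Definition alternating (s : seq bool) : bool := sorted (fun i j => i != j) s.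

Inductive tensor_rel : fwords -> Prop :=
| tensor_rel0 : tensor_rel 0
| tensor_relP a p q : tensor_rel p -> tensor_rel q -> tensor_rel (a *: p + q)
| tensor_rel_alt w : ~~ alternating (labels w) -> tensor_rel << w >>
| tensor_rel_lin u (i : bool) a (x y : V i) v :
    tensor_rel (<< u ++ Tagged V (a *: x + y) :: v >>
      - (a *: << u ++ Tagged V x :: v >> + << u ++ Tagged V y :: v >>)).

Definition in_tensor_rel : {pred fwords} := fun p => `[< tensor_rel p >].

Fact in_tensor_rel_zmod : zmod_closed in_tensor_rel.
Proof.
split=> [|p q]; rewrite !unfold_in; first exact/asboolP/tensor_rel0.
move=> /asboolP hp /asboolP hq; apply/asboolP.
by rewrite addrC -scaleN1r; apply: tensor_relP.
Qed.

HB.instance Definition _ :=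
  GRing.isZmodClosed.Build fwords in_tensor_rel in_tensor_rel_zmod.

Local Notation fquot := (@Quotient.quot fwords in_tensor_rel).
Definition free_prod : Type := fquot.
HB.instance Definition _ := GRing.Zmodule.on free_prod.

Definition fp_class (p : fwords) : free_prod := \pi_fquot p.

Fact fp_classP p q : reflect (tensor_rel (p - q)) (fp_class p == fp_class q).
Proof.
by rewrite /fp_class eqquotE Quotient.equivE unfold_in; apply: asboolP.
Qed.

Fact fp_classK (x : free_prod) : fp_class (repr (x : fquot)) = x.
Proof. exact: reprK. Qed.

Fact fp_classD p q : fp_class (p + q) = fp_class p + fp_class q.
Proof. exact: Quotient.pi_add. Qed.

Fact tensor_relZ a p : tensor_rel p -> tensor_rel (a *: p).
Proof. by move=> hp; rewrite -[_ *: _]addr0; apply: tensor_relP hp tensor_rel0. Qed.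

Definition fp_scale (a : K) (x : free_prod) : free_prod :=
  fp_class (a *: repr (x : fquot)).

Fact fp_scale_class a p : fp_scale a (fp_class p) = fp_class (a *: p).
Proof.
apply/eqP/fp_classP; rewrite -scalerBr; apply: tensor_relZ.
by apply/fp_classP; rewrite fp_classK.
Qed.

Fact fp_scaleA a b x : fp_scale a (fp_scale b x) = fp_scale (a * b) x.
Proof. by rewrite -[x]fp_classK !fp_scale_class scalerA. Qed.

Fact fp_scale1 x : fp_scale 1 x = x.
Proof. by rewrite -[x]fp_classK fp_scale_class scale1r. Qed.

Fact fp_scaleDr a x y : fp_scale a (x + y) = fp_scale a x + fp_scale a y.
Proof.
rewrite -[x]fp_classK -[y]fp_classK -fp_classD !fp_scale_class -fp_classD.
by rewrite scalerDr.
Qed.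

Fact fp_scaleDl x a b : fp_scale (a + b) x = fp_scale a x + fp_scale b x.
Proof. by rewrite -[x]fp_classK !fp_scale_class -fp_classD scalerDl. Qed.

HB.instance Definition _ := GRing.Zmodule_isLmodule.Build K free_prod
  fp_scaleA fp_scale1 fp_scaleDr fp_scaleDl.

Fact fp_class_linear : linear fp_class.
Proof. by move=> a p q; rewrite fp_classD -fp_scale_class. Qed.

HB.instance Definition _ :=
  GRing.isLinear.Build K fwords free_prod *:%R fp_class fp_class_linear.

Definition fp_word (w : seq letter) : free_prod := fp_class << w >>.

Definition fp_vacuum : free_prod := fp_word [::].

Lemma fp_word_lin u (i : bool) a (x y : V i) v :
  fp_word (u ++ Tagged V (a *: x + y) :: v) =
  a *: fp_word (u ++ Tagged V x :: v) + fp_word (u ++ Tagged V y :: v).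
Proof.
rewrite /fp_word -linearP; apply/eqP/fp_classP; exact: tensor_rel_lin.
Qed.

Lemma fp_word_nalt w : ~~ alternating (labels w) -> fp_word w = 0.
Proof.
move=> hw; rewrite /fp_word -(linear0 fp_class); apply/eqP/fp_classP.
by rewrite subr0; apply: tensor_rel_alt.
Qed.

(* Universal property of free_prod. *)
Section Lift.
Variables (M : lmodType K) (f : seq letter -> M).

Definition multilinear_alt : Prop :=
  (forall u (i : bool) a (x y : V i) v,
     f (u ++ Tagged V (a *: x + y) :: v) =
     a *: f (u ++ Tagged V x :: v) + f (u ++ Tagged V y :: v)) /\
  (forall w, ~~ alternating (labels w) -> f w = 0).

Definition fp_lift (x : free_prod) : M := fglift f (repr (x : fquot)).

Fact fglift_linear : linear (fglift f).
Proof.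
have add p q : fglift f (p - q) = fglift f p - fglift f q.
  exact: lift_is_additive.
have add0 : fglift f 0 = 0 by rewrite -[0 in LHS](subrr 0) add subrr.
have addN q : fglift f (- q) = - fglift f q by rewrite -[- q]add0r add add0 add0r.
have addD p q : fglift f (p + q) = fglift f p + fglift f q.
  by rewrite -[q in LHS]opprK add addN opprK.
have addS (I : Type) (r : seq I) (F : I -> fwords) :
    fglift f (\sum_(i <- r) F i) = \sum_(i <- r) fglift f (F i).
  exact: (big_morph _ addD add0).
move=> a p q; rewrite addD; congr (_ + _).
rewrite -[in RHS](freeg_sumE p) addS scaler_sumr.
rewrite [a *: p]/(fgscale a p) /fgscale addS.
by apply: eq_bigr => w _; rewrite !liftU scalerA.
Qed.

HB.instance Definition _ :=
  GRing.isLinear.Build K fwords M *:%R (fglift f) fglift_linear.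

Hypothesis fP : multilinear_alt.

Fact fglift_rel p : tensor_rel p -> fglift f p = 0.
Proof.
elim=> [|a {}p q _ hp _ hq|w hw|u i a x y v].
- exact: linear0.
- by rewrite fglift_linear hp hq scaler0 addr0.
- by rewrite liftU fP.2 // scaler0.
- by rewrite linearB /= fglift_linear !liftU !scale1r fP.1 subrr.
Qed.

Fact fp_lift_class p : fp_lift (fp_class p) = fglift f p.
Proof.
apply/eqP; rewrite -subr_eq0 -linearB; apply/eqP/fglift_rel.
by apply/fp_classP; rewrite fp_classK.
Qed.

Lemma fp_lift_word w : fp_lift (fp_word w) = f w.
Proof. by rewrite fp_lift_class liftU scale1r. Qed.

Lemma fp_lift_linear : linear fp_lift.
Proof.
move=> a x y; rewrite -[x]fp_classK -[y]fp_classK -linearP !fp_lift_class.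
exact: linearP.
Qed.
End Lift.

Lemma fp_ind (M : lmodType K) (f g : free_prod -> M) :
  linear f -> linear g ->
  (forall w, alternating (labels w) -> f (fp_word w) = g (fp_word w)) -> f =1 g.
Proof.
move=> lf lg fg x.
pose F : {linear free_prod -> M} := HB.pack f (GRing.isLinear.Build _ _ _ _ f lf).
pose G : {linear free_prod -> M} := HB.pack g (GRing.isLinear.Build _ _ _ _ g lg).
rewrite -[f]/(F : _ -> _) -[g]/(G : _ -> _).
rewrite -[x]fp_classK -[repr _]freeg_sumE !linear_sum; apply: eq_bigr => w _.
have -> (c : K) : << c *g w >> = c *: << w >> :> fwords.
  by apply/eqP/freeg_eqP => v; rewrite coeffZ !coeffU mul1r.
rewrite !linearZ /= -/(fp_word w); congr (_ *: _).
have [hw|/fp_word_nalt ->] := boolP (alternating (labels w)); first exact: fg.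
exact: etrans (linear0 F) (esym (linear0 G)).
Qed.

(* The projection onto K xi along X°: the coefficient of the empty word. *)
Definition vacuum_coef : free_prod -> K := fp_lift (fun w => (w == [::])%:R : K^o).

Definition vacuum_state (S : free_prod -> free_prod) : K :=
  vacuum_coef (S fp_vacuum).

Fact vacuum_coef_mult : multilinear_alt (fun w => (w == [::])%:R : K^o).
Proof.
split=> [[|l u] i a x y v|[|l w]] //=; by rewrite scaler0 addr0.
Qed.

Lemma vacuum_coef_linear : linear (vacuum_coef : free_prod -> K^o).
Proof. exact: fp_lift_linear vacuum_coef_mult. Qed.

Lemma vacuum_coef_word w : vacuum_coef (fp_word w) = (w == [::])%:R.
Proof. exact: fp_lift_word vacuum_coef_mult w. Qed.

(* X_i, with distinguished vector (1, 0). *)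
Definition pointed (i : bool) : Type := (K^o * V i)%type.
HB.instance Definition _ i := GRing.Lmodule.on (pointed i).

(* concat_l z w is V_i (z (x) w), for a word w whose first label is not i, and
   concat_r w z is W_i (w (x) z), for a word w whose last label is not i. *)
Definition concat_l i (z : pointed i) (w : seq letter) : free_prod :=
  z.1 *: fp_word w + fp_word (Tagged V z.2 :: w).

Definition concat_r i (w : seq letter) (z : pointed i) : free_prod :=
  z.1 *: fp_word w + fp_word (rcons w (Tagged V z.2)).

(* S V_i = V_i (T (x) I), resp. S W_i = W_i (I (x) T); as these words w span
   X(l, i), resp. X(r, i), this says S = V_i (T (x) I) V_i^-1, resp.
   S = W_i (I (x) T) W_i^-1. *)
Definition is_lambda i (T : pointed i -> pointed i)
    (S : free_prod -> free_prod) : Prop :=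
  linear S /\
  forall z w, alternating (i :: labels w) ->
    S (concat_l z w) = concat_l (T z) w.

Definition is_rho i (T : pointed i -> pointed i)
    (S : free_prod -> free_prod) : Prop :=
  linear S /\
  forall w z, alternating (rcons (labels w) i) ->
    S (concat_r w z) = concat_r w (T z).

Definition lambda_op i (T : pointed i -> pointed i) : free_prod -> free_prod :=
  xget (fun=> 0) [set S | is_lambda T S].

Definition rho_op i (T : pointed i -> pointed i) : free_prod -> free_prod :=
  xget (fun=> 0) [set S | is_rho T S].

Section Existence.
Variable i : bool.
Implicit Types (T : pointed i -> pointed i) (z : pointed i).

Fact concat_l_linear w : linear (fun z => concat_l z w).
Proof.
move=> a x y; rewrite /concat_l /= (fp_word_lin [::]) /=.
by rewrite scalerDl scalerDr scalerA addrACA.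
Qed.

Fact concat_l_mult z u j a (x y : V j) v :
  concat_l z (u ++ Tagged V (a *: x + y) :: v) =
  a *: concat_l z (u ++ Tagged V x :: v) + concat_l z (u ++ Tagged V y :: v).
Proof.
rewrite /concat_l -!cat_cons !fp_word_lin !scalerDr !scalerA mulrC addrACA.
by rewrite -!scalerA.
Qed.

Let lambda_word T (w : seq letter) : free_prod :=
  if ~~ alternating (labels w) then 0 else
  if w is l :: w' then
    if tag l == i then
      concat_l (T (0, tagged_as (Tagged V (0 : V i)) l)) w'
    else concat_l (T (1, 0)) w
  else concat_l (T (1, 0)) w.

Fact lambda_word_mult T : linear T -> multilinear_alt (lambda_word T).
Proof.
move=> linT; split=> [u j a x y v|w hw]; last by rewrite /lambda_word hw.
rewrite /lambda_word /labels !map_cat /=.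
case: (alternating _); rewrite /= ?scaler0 ?addr0 //.
case: u => [|l u] /=; last by case: ifP => _; rewrite -?cat_cons concat_l_mult.
case: eqP => [e|_]; last exact: (concat_l_mult _ [::]).
subst j; rewrite !tagged_asE -concat_l_linear -linT.
by congr (concat_l (T _) _); congr pair; rewrite /= ?scaler0 ?addr0.
Qed.

Lemma lambda_exists T : linear T -> exists S, is_lambda T S.
Proof.
move=> linT; exists (fp_lift (lambda_word T)).
have lm := lambda_word_mult linT.
split=> [|[c y] w hw]; first exact: fp_lift_linear.
rewrite /concat_l /= fp_lift_linear // !fp_lift_word // -/(concat_l _ _).
have hw' : alternating (labels w) := path_sorted hw.
have hwy : alternating (labels (Tagged V y :: w)) := hw.
rewrite /lambda_word hwy hw' /= eqxx tagged_asE.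
have -> : (c, y) = c *: ((1, 0) : pointed i) + (0, y).
  by congr pair; rewrite /= ?scaler0 ?add0r ?addr0 //; exact/esym/mulr1.
rewrite linT concat_l_linear; congr (c *: _ + _).
case: w hw {hw' hwy} => [//|l w] /= /andP[+ _].
by rewrite eq_sym => /negbTE ->.
Qed.

Lemma lambdaP T : linear T -> is_lambda T (lambda_op T).
Proof.
by move=> /lambda_exists[S hS]; apply: (xgetPex (fun=> 0)); exists S.
Qed.

Fact alternating_rev s : alternating (rev s) = alternating s.
Proof.
rewrite /alternating rev_sorted; apply: eq_sorted => x y /=.
by rewrite eq_sym.
Qed.

Let flip : free_prod -> free_prod := fp_lift (fp_word \o rev).

Fact flip_mult : multilinear_alt (fp_word \o rev).
Proof.
split=> [u j a x y v|w hw] /=.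
  by rewrite !rev_cat !rev_cons !cat_rcons fp_word_lin.
by apply: fp_word_nalt; rewrite /labels map_rev alternating_rev.
Qed.

Lemma rho_exists T : linear T -> exists S, is_rho T S.
Proof.
move=> /lambda_exists[S [linS SP]]; exists (flip \o S \o flip).
have linF : linear flip by apply: fp_lift_linear flip_mult.
have flipE w : flip (fp_word w) = fp_word (rev w).
  exact: fp_lift_word flip_mult w.
split=> [a x y|w z hw] /=; first by rewrite !linF linS linF.
have -> : flip (concat_r w z) = concat_l z (rev w).
  by rewrite /concat_r linF !flipE rev_rcons.
rewrite SP ?linF ?flipE /concat_l ?linF ?flipE ?rev_cons ?revK //.
by rewrite /labels map_rev -rev_rcons alternating_rev.
Qed.

Lemma rhoP T : linear T -> is_rho T (rho_op T).
Proof.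
by move=> /rho_exists[S hS]; apply: (xgetPex (fun=> 0)); exists S.
Qed.

End Existence.

End FreeProduct.

Record hilbertSpace (R : realType) := HilbertSpace {
  hilbert_carrier :> completeNormedModType R[i];
  inner : {dot hilbert_carrier for @Num.conj R[i]};
  inner_norm : forall x : hilbert_carrier, `|x| ^+ 2 = inner x x }.

Section Operators.
Variables (R : realType) (H : hilbertSpace R).
Local Notation C := R[i].
Local Notation "''[' x , y ]" := (inner H x y).
Implicit Types (P Q S T : H -> H) (A D : set (H -> H)) (phi : (H -> H) -> C).

Definition bounded_op T : Prop := linear T /\ continuous T.

Definition is_adjoint T S : Prop := forall x y, '[T x, y] = '[x, S y].

Definition self_adjoint T : Prop := is_adjoint T T.

(* The order of R[i] is partial: a <= b means that b - a is real and >= 0. *)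
Definition op_le S T : Prop := forall x, '[S x, x] <= '[T x, x].

Definition wot_closed A : Prop :=
  forall T, bounded_op T ->
    (forall (n : nat) (x y : 'I_n -> H) (e : C), 0 < e ->
       exists2 S, A S & forall k, `|'[T (x k) - S (x k), y k]| < e) ->
    A T.

Definition von_neumann_algebra A : Prop :=
  [/\ A `<=` bounded_op,
      A id,
      (forall (c : C) S T, A S -> A T -> A (c *: S + T)) /\
      (forall S T, A S -> A T -> A (S \o T)),
      (forall T, A T -> exists2 S, A S & is_adjoint T S) &
      wot_closed A].

Definition directed D : Prop :=
  D !=set0 /\
  forall S T, D S -> D T -> exists2 U, D U & op_le S U /\ op_le T U.

Definition op_sup A D S : Prop :=
  [/\ A S, self_adjoint S, (forall T, D T -> op_le T S) &
      forall U, A U -> self_adjoint U -> (forall T, D T -> op_le T U) ->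
        op_le S U].

(* phi is only meaningful on A. *)
Definition state A phi : Prop :=
  [/\ forall (c : C) S T, A S -> A T -> phi (c *: S + T) = c * phi S + phi T,
      forall T, A T -> op_le (fun=> 0) T -> 0 <= phi T &
      phi id = 1].

Definition normal A phi : Prop :=
  forall D S, D `<=` A -> D `<=` self_adjoint -> directed D -> op_sup A D S ->
    supremums (phi @` D) (phi S).

Definition wstar_probability_space A phi : Prop :=
  [/\ von_neumann_algebra A, state A phi & normal A phi].

Definition projection_in A P : Prop :=
  [/\ A P, self_adjoint P & P \o P = P].

Definition orthogonal_projection (E : set H) : H -> H :=
  fun x => xget 0 [set y | E y /\ forall z, E z -> '[x - y, z] = 0].

Definition meet P Q : H -> H :=
  orthogonal_projection (range P `&` range Q).

Section BiFree.
Implicit Types (p : (H -> H) * (H -> H)).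

(* The product, in the order of s, of the operators (c i).1 for (i, true) in s
   and (c i).2 for (i, false) in s. *)
Definition monomial (X : Type) (c : bool -> (X -> X) * (X -> X))
    (s : seq (bool * bool)) : X -> X :=
  foldr (fun k f => (if k.2 then (c k.1).1 else (c k.1).2) \o f) id s.

Definition bi_free phi p1 p2 : Prop :=
  exists (V : bool -> lmodType C) (S T : forall i, pointed V i -> pointed V i),
  [/\ forall i, linear (S i), forall i, linear (T i) &
      forall s : seq (bool * bool),
        phi (monomial (fun i => if i then p1 else p2) s) =
        vacuum_state
          (monomial (fun i => (lambda_op (S i), rho_op (T i))) s)].

End BiFree.
End Operators.

(* Main.v *)
Require Import Defs.
From HB Require Import structures.
From mathcomp Require Import all_boot all_order all_algebra.
From mathcomp Require Import all_classical all_reals all_analysis.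
From mathcomp Require Import complex ring lra.

Set Implicit Arguments.
Unset Strict Implicit.
Unset Printing Implicit Defensive.

Import Order.TTheory GRing.Theory Num.Theory.
Import numFieldNormedType.Exports.

Local Open Scope classical_set_scope.
Local Open Scope ring_scope.

(** The index [true] refers to the pair [(P, Q)] and [false] to [(P', Q')]; write
    [P_b], [Q_b] for the projections with index [b] and [p_b], [q_b] for their
    states; in formulas, a prime marks the index [false].

    Left face. Put [g_b = P_b / p_b - 1] and [x_b = (1 - p_b) / p_b]. Freeness of
    the two left projections says that the alternating words in the [g_b] are
    orthogonal in the inner product given by [phi], the squared norm of a word
    being the product of the [x_b] over its letters ([st_altr_altl]). The meet
    [E] of the projections satisfies [g_b E = x_b E]; therefore the component of
    [E] along each word is [phi E] times this word, and, as [E] is the limit of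
    the powers of [P P' P], it is as a vector [phi E] times the sum of all
    alternating words. That sum has squared norm
    [(1 + x) (1 + x') / (1 - x x') = 1 / (p + p' - 1)] if [x x' < 1], which means
    [p + p' > 1], and is not square-summable otherwise; so [phi E], being the squared norm
    of [E], must be [p + p' - 1] or 0. To turn this into a proof the sum is
    truncated. Bessel's inequality ([st_meet_word_sum_le]) gives the upper bound.
    For the lower bound, the inner product with the sum of all words is the
    character mapping both projections to 1 ([st_prod_word_sum]), so that
    Cauchy-Schwarz bounds the states of the powers of [P P' P] from below
    ([st_compression_exp_ge]); these powers converge strongly to [E]
    ([iter_cvg_meet]), and normality passes the bound on to [E]
    ([normal_meet]). Nothing here distinguishes the left face from the right one.

    Both faces. In the free product a left word [a_1 ... a_n] applied to the vector
    created by a right word must erase all of its letters to reach the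
    distinguished vector, and can do so only if the two words have the same labels
    ([vac_altr_op_pair]). With [y_b = phi (P_b Q_b) / (p_b q_b) - 1], the inner
    product of the left word sum with the right one is thus the sum over
    all alternating words of the products of the [y_b]. If [phi E] and [phi F] are
    positive, where [F] is the meet on the right, then [E] and [F] are
    approximated in norm by the truncated sums times [phi E] and [phi F], whence
    [phi (E F) = phi E phi F (1 + y) (1 + y') / (1 - y y')]; the convergence of
    the partial sums is a consequence of the approximation
    ([cvg_word_sum_st_meets]) and forces this value ([word_sum_cvg_val]). Taking
    inverses gives the formula. The degenerate cases follow from Cauchy-Schwarz,
    using [E F = P_b Q_b E F] when [phi (P_b Q_b) = 0]. *)

Local Notation "x %:C" := (real_complex _ x).

(** * Alternating products *)

Section AlternatingProducts.
Variable S : pzSemiRingType.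
Implicit Types (x : bool -> S) (b : bool) (n : nat).

(** An alternating product is named by its first label in [altl] and by its last
    label in [altr]: the labels that face each other in a product
    [altr x b m * altl y f k] are then [b] and [f]. *)
Fixpoint altl x b n : S := if n is n'.+1 then x b * altl x (~~ b) n' else 1.

Fixpoint altr x b n : S := if n is n'.+1 then altr x (~~ b) n' * x b else 1.

Lemma altl_snoc x b n : altl x b n.+1 = altl x b n * x (b (+) odd n).
Proof.
elim: n b => [|n IHn] b; first by rewrite /= mul1r mulr1 addbF.
rewrite [LHS]/= -/(altl x (~~ b) n.+1) IHn mulrA /=.
by rewrite addbN addNb.
Qed.

Lemma altlE x b n : altl x b n = altr x (b (+) ~~ odd n) n.
Proof.
elim: n => [//|n IHn] in b *.
by rewrite altl_snoc IHn /= negbK addbN.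
Qed.

(** The empty word has no first label and must be counted once, whereas for each
    positive length there is one alternating word for each label. *)
Definition layer (w : bool -> nat -> S) n : S :=
  if n is 0 then 1 else w true n + w false n.

Definition word_sum (w : bool -> nat -> S) N : S := \sum_(n < N) layer w n.

(** Naming words by the last label instead of the first one permutes the two
    words of each length. *)
Lemma word_sum_lr x N : word_sum (altl x) N = word_sum (altr x) N.
Proof.
apply: eq_bigr => -[[|n] /= _] _ //.
rewrite -!/(altl x _ n.+1) -!/(altr x _ n.+1) !altlE.
by case: (odd _) => //=; rewrite addrC.
Qed.

End AlternatingProducts.

Lemma altr_com (S : comPzSemiRingType) (x : bool -> S) b n :
  altr x b n = altl x b n.
Proof. by elim: n b => //= n IHn b; rewrite IHn mulrC. Qed.

Lemma altl_rmorph (S T : pzSemiRingType) (f : {rmorphism S -> T}) x b n :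
  altl (fun b => f (x b)) b n = f (altl x b n).
Proof. by elim: n b => [|n IHn] b /=; rewrite ?rmorph1 // rmorphM IHn. Qed.

Lemma word_sum_rmorph (S T : pzSemiRingType) (f : {rmorphism S -> T}) x N :
  word_sum (altl (fun b => f (x b))) N = f (word_sum (altl x) N).
Proof.
rewrite /word_sum rmorph_sum; apply: eq_bigr => -[[|n] /= _] _.
  by rewrite /= rmorph1.
by rewrite !altl_rmorph -!rmorphM -rmorphD.
Qed.

Section WordSumClosedForm.
Variables (S : comPzRingType) (x : bool -> S).
Let z := x true * x false.

Lemma altl_double b k : altl x b k.*2 = z ^+ k.
Proof.
elim: k => [|k IHk]; first by rewrite expr0.
rewrite doubleS /= negbK IHk exprS mulrA /z.
by case: b {IHk} => //=; rewrite [x false * _]mulrC.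
Qed.

(** The lengths [2 i] and [2 i + 1] together contribute [2 z^i] and
    [(x true + x false) z^i], except that the empty word counts for 1 and not 2. *)
Lemma word_sum_double k :
  word_sum (altl x) k.*2 = (2 + x true + x false) * \sum_(i < k) z ^+ i - (0 < k)%:R.
Proof.
elim: k => [|k IHk]; first by rewrite /word_sum !big_ord0 mulr0 subr0.
rewrite /word_sum doubleS 2!big_ord_recr /= -/(word_sum _ _) IHk.
rewrite !altl_double [in RHS]big_ord_recr /=.
case: k {IHk} => [|k]; first by rewrite /= !expr0 !big_ord0; ring.
have -> : layer (altl x) k.+1.*2 = 2 * z ^+ k.+1.
  by rewrite /layer doubleS -doubleS !altl_double; ring.
by rewrite /=; ring.
Qed.
End WordSumClosedForm.

(** * Sums over all alternating words of real numbers *)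

Section WordSumLimits.
Variables (R : realType) (x : bool -> R).
Let z := x true * x false.
Let s K := word_sum (altl x) K.*2.

Lemma word_sum_succ K : s K.+1 = (2 + x true + x false) * \sum_(i < K.+1) z ^+ i - 1.
Proof. exact: word_sum_double. Qed.

Lemma word_sum_mul K :
  (s K.+1 + 1) * (1 - z) = (2 + x true + x false) * (1 - z ^+ K.+1).
Proof.
by rewrite word_sum_succ subrK -[1 - z ^+ _]opprB subrX1; ring.
Qed.

Lemma cvg_word_sum : (forall b, 0 <= x b) -> z < 1 ->
  s @ \oo --> (1 + x true) * (1 + x false) / (1 - z).
Proof.
move=> x0 z1; have z0 : 0 <= z by rewrite mulr_ge0.
have nz : 1 - z != 0 by rewrite subr_eq0 gt_eqF.
rewrite -cvg_shiftS.
have -> : [sequence s n.+1]_n =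
   (fun n => (2 + x true + x false) / (1 - z) * (1 - z ^+ n.+1) - 1).
  apply/funext => n /=; apply/eqP; rewrite eq_sym subr_eq eq_sym; apply/eqP.
  by apply: (mulIf nz); rewrite word_sum_mul; field.
have -> : (1 + x true) * (1 + x false) / (1 - z) =
  (2 + x true + x false) / (1 - z) * (1 - 0) - 1 by rewrite /z; field.
apply: cvgB; last exact: cvg_cst.
apply: cvgM; first exact: cvg_cst.
apply: cvgB; first exact: cvg_cst.
by rewrite (cvg_shiftS (fun n => z ^+ n)); apply: cvg_expr; rewrite ger0_norm.
Qed.

Lemma word_sum_le N : (forall b, 0 <= x b) -> z < 1 ->
  word_sum (altl x) N <= (1 + x true) * (1 + x false) / (1 - z).
Proof.
move=> x0 z1; have cv := cvg_word_sum x0 z1.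
have mono M M' : (M <= M')%N -> word_sum (altl x) M <= word_sum (altl x) M'.
  have a0 n b : 0 <= altl x b n by elim: n b => //= n IHn b; rewrite mulr_ge0.
  move=> MM; rewrite /word_sum -(subnKC MM) big_split_ord /= lerDl.
  by apply: sumr_ge0 => i _; case: (M + i)%N => //= n; rewrite addr_ge0 // mulr_ge0.
rewrite -(cvg_lim (@Rhausdorff R) cv); apply: limr_ge.
  by apply/cvg_ex; eexists; exact: cv.
near=> K; apply: mono.
rewrite -muln2 (leq_trans _ (leq_pmulr _ _)) //.
near: K; exact: nbhs_infty_ge.
Unshelve. all: by end_near. Qed.

(** If [z] were at least 1, the geometric sums would grow at least linearly;
    hence [z < 1], and the bound passes to the limit. *)
Lemma word_sum_bounded e : (forall b, 0 <= x b) -> 0 < e ->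
  (forall N, e * word_sum (altl x) N <= 1) ->
  z < 1 /\ e * ((1 + x true) * (1 + x false)) <= 1 - z.
Proof.
move=> x0 e0 he.
have z1 : z < 1.
  rewrite ltNge; apply/negP => z1.
  have [n hn] : exists n : nat, 1 / e < n.+1%:R.
    exists (Num.bound (1 / e)); apply: lt_trans (archi_boundP _) _.
      by rewrite divr_ge0 // ltW.
    by rewrite ltr_nat.
  have := he n.+1.*2; rewrite -/(s n.+1) word_sum_succ.
  have : n.+1%:R <= \sum_(i < n.+1) z ^+ i.
    rewrite -[n.+1 in X in X <= _]card_ord -sumr_const.
    by apply: ler_sum => i _; rewrite exprn_ege1.
  move: (\sum_(i < _) _) => G hG.
  rewrite ltr_pdivrMr // in hn.
  have n1 : 1 <= n.+1%:R :> R by rewrite ler1n.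
  have := x0 true; have := x0 false => xf xt h.
  have G1 : 1 <= G := le_trans n1 hG.
  have h1 : e * n.+1%:R <= e * G by rewrite ler_pM2l.
  have h2 : 0 <= e * ((x true + x false) * G).
    by rewrite !mulr_ge0 ?addr_ge0 // ?ltW // (lt_le_trans ltr01).
  have h3 : e * 1 <= e * G by rewrite ler_pM2l.
  lra.
split=> //.
have cv := cvg_word_sum x0 z1.
have cv' : (fun K => e * s K) @ \oo --> e * ((1 + x true) * (1 + x false) / (1 - z)).
  by apply: cvgM => //; apply: cvg_cst.
rewrite -[1 - z]mul1r -ler_pdivrMr ?subr_gt0 // -mulrA -(cvg_lim (@Rhausdorff R) cv').
apply: limr_le; first by apply/cvg_ex; eexists; exact: cv'.
by near=> K; exact: he.
Unshelve. all: by end_near. Qed.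

(** Convergence forces [z^n] to tend to 0, since [z^n] is proportional to the
    difference of two consecutive sums; the closed form then gives the limit. *)
Lemma word_sum_cvg_val (f : R) : 2 + x true + x false != 0 -> s @ \oo --> f ->
  f * (1 - z) = (1 + x true) * (1 + x false).
Proof.
move=> nz cv; set k := 2 + _ + _ in nz.
have cv1 : (fun n => s n.+1) @ \oo --> f by have := cv; rewrite -cvg_shiftS.
have cv2 : (fun n => s n.+2) @ \oo --> f.
  by have := cv1; rewrite -(cvg_shiftS (fun n => s n.+1)).
have zE : (fun n => z ^+ n.+1) = (fun n => (s n.+2 - s n.+1) / k).
  apply/funext => n; rewrite !word_sum_succ -/k [in RHS]big_ord_recr /=.
  by field.
have z0 : (fun n => z ^+ n.+1) @ \oo --> (0 : R).
  rewrite zE -[0](mul0r k^-1) -(subrr f).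
  by apply: cvgM; [apply: cvgB | apply: cvg_cst].
have cvL : (fun n => (s n.+1 + 1) * (1 - z)) @ \oo --> (f + 1) * (1 - z).
  by apply: cvgM; [apply: cvgD => //; apply: cvg_cst | apply: cvg_cst].
have cvR : (fun n => (s n.+1 + 1) * (1 - z)) @ \oo --> k * (1 - 0).
  under eq_fun do rewrite word_sum_mul.
  by apply: cvgM; [apply: cvg_cst | apply: cvgB => //; apply: cvg_cst].
have h := cvg_unique (@Rhausdorff R) cvL cvR.
have -> : f * (1 - z) = (f + 1) * (1 - z) - (1 - z) by ring.
by rewrite h /k /z; ring.
Qed.

End WordSumLimits.

(** * Algebras with a state *)

(** The adjoint is a relation and not an operation: only elements with a known
    adjoint occur, and no adjoint has to be chosen. *)
Record starProb (C : numClosedFieldType) := StarProb {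
  sp_alg :> algType C;
  adj : sp_alg -> sp_alg -> Prop;
  st : {scalar sp_alg};
  adj_lin : forall c a a' b b',
    adj a a' -> adj b b' -> adj (c *: a + b) (Num.conj c *: a' + b');
  adjM : forall a a' b b', adj a a' -> adj b b' -> adj (a * b) (b' * a');
  adj1 : adj 1 1;
  adj_sym : forall a a', adj a a' -> adj a' a;
  st_ge0 : forall a a', adj a a' -> 0 <= st (a' * a);
  st1 : st 1 = 1 }.

Section StarProbTheory.
Variables (C : numClosedFieldType) (B : starProb C).
Implicit Types (a b : B) (c : C).
Local Notation phi := (@st C B).

Lemma stD a b : phi (a + b) = phi a + phi b. Proof. exact: linearD. Qed.

Lemma stB a b : phi (a - b) = phi a - phi b. Proof. exact: linearB. Qed.

Lemma stZ c a : phi (c *: a) = c * phi a. Proof. exact: linearZ. Qed.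

Lemma adjD a a' b b' : adj a a' -> adj b b' -> adj (a + b) (a' + b').
Proof.
by move=> ha hb; have := adj_lin 1 ha hb; rewrite conjC1 !scale1r.
Qed.

Lemma adj0 : adj (0 : B) 0.
Proof.
have := adj_lin (-1) (adj1 B) (adj1 B).
by rewrite rmorphN1 scaleN1r addrC subrr.
Qed.

Lemma adjZ c a a' : adj a a' -> adj (c *: a) (Num.conj c *: a').
Proof. by move=> ha; have := adj_lin c ha adj0; rewrite !addr0. Qed.

Lemma adjB a a' b b' : adj a a' -> adj b b' -> adj (a - b) (a' - b').
Proof.
move=> ha hb; have := adj_lin (-1) hb ha.
by rewrite rmorphN1 !scaleN1r addrC [_ + a']addrC.
Qed.

Lemma st_sesqui_expand c a a' b b' :
  phi ((a' + Num.conj c *: b') * (a + c *: b)) =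
  phi (a' * a) + c * phi (a' * b) + Num.conj c * phi (b' * a)
    + c * Num.conj c * phi (b' * b).
Proof.
have -> : (a' + Num.conj c *: b') * (a + c *: b) = a' * a + c *: (a' * b)
    + Num.conj c *: (b' * a) + (c * Num.conj c) *: (b' * b).
  by rewrite mulrDl !mulrDr -!scalerAl -!scalerAr scalerA addrA [c * _]mulrC.
by rewrite !linearD !linearZ.
Qed.

(** Polarization: [phi] is real on the squares of [a + b] and [a + 'i b]. *)
Lemma st_conj_mul a a' b b' :
  adj a a' -> adj b b' -> phi (b' * a) = Num.conj (phi (a' * b)).
Proof.
move=> ha hb.
have re (c : C) : c * phi (a' * b) + Num.conj c * phi (b' * a) \is Num.real.
  have hab : adj (a + c *: b) (a' + Num.conj c *: b') by apply: adjD => //; apply: adjZ.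
  have -> : c * phi (a' * b) + Num.conj c * phi (b' * a) =
     phi ((a' + Num.conj c *: b') * (a + c *: b)) - phi (a' * a)
     - c * Num.conj c * phi (b' * b) by rewrite st_sesqui_expand; ring.
  have nn := (ger0_real (st_ge0 hab), ger0_real (st_ge0 ha), ger0_real (st_ge0 hb)).
  by rewrite !rpredB ?nn // rpredM ?nn // ger0_real // mul_conjC_ge0.
move: (phi (a' * b)) (phi (b' * a)) re => z w re.
have := re 1; have := re 'i.
rewrite !CrealE conjC1 conjCi !mul1r !rmorphD !rmorphM rmorphN /= conjCi.
move=> /eqP h1 /eqP h2.
have i0 : 'i != 0 :> C by exact: neq0Ci.
have h3 : Num.conj w - Num.conj z = z - w.
  apply: (mulfI i0); rewrite !mulrBr.
  have -> : 'i * z - 'i * w = 'i * z + - 'i * w by ring.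
  by rewrite -h1; ring.
apply: (@mulIf _ (2%:R : C)); first by rewrite pnatr_eq0.
have -> : w * 2 = (z + w) - (z - w) by ring.
by rewrite -h2 -h3; ring.
Qed.

Lemma st_conj a a' : adj a a' -> phi a' = Num.conj (phi a).
Proof. by move=> ha; have := st_conj_mul (adj1 B) ha; rewrite mul1r mulr1. Qed.

Lemma st_sa_real a : adj a a -> phi a \is Num.real.
Proof. by move=> ha; rewrite CrealE -(st_conj ha). Qed.

(** Cauchy-Schwarz in the case where one vector has norm at most 1: positivity at
    [a - (conj z) b] then suffices, without dividing by the norm of [b]. *)
Lemma st_CS_left a a' b b' : adj a a' -> adj b b' -> phi (b' * b) <= 1 ->
  `|phi (a' * b)| ^+ 2 <= phi (a' * a).
Proof.
move=> ha hb hb1; set z := phi (a' * b).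
have hab : adj (a + - Num.conj z *: b) (a' + Num.conj (- Num.conj z) *: b').
  by apply: adjD => //; apply: adjZ.
have := st_ge0 hab; rewrite st_sesqui_expand.
rewrite (st_conj_mul ha hb) -/z rmorphN /= conjCK => h.
rewrite -subr_ge0; apply: le_trans h _; rewrite normCK.
have -> : phi (a' * a) + - Num.conj z * z + - z * Num.conj z
     + - Num.conj z * - z * phi (b' * b) =
   phi (a' * a) - z * Num.conj z - z * Num.conj z * (1 - phi (b' * b)) by ring.
by rewrite lerBlDr lerDl mulr_ge0 ?subr_ge0 ?mul_conjC_ge0.
Qed.

Lemma st_CS_right a a' b b' : adj a a' -> adj b b' -> phi (a' * a) <= 1 ->
  `|phi (a' * b)| ^+ 2 <= phi (b' * b).
Proof.
move=> ha hb ha1; rewrite -norm_conjC -(st_conj_mul ha hb).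
exact: st_CS_left hb ha ha1.
Qed.

Lemma adj_altl g n f : (forall f, adj (g f : B) (g f)) ->
  adj (altl g f n) (altr g f n).
Proof. by move=> hg; elim: n f => [|n IHn] f /=; [apply: adj1 | apply: adjM]. Qed.

(** Taking adjoints reverses words, which permutes the alternating ones. *)
Lemma adj_word_sum g N : (forall f, adj (g f : B) (g f)) ->
  adj (word_sum (altl g) N) (word_sum (altl g) N).
Proof.
move=> hg; rewrite {2}word_sum_lr /word_sum.
elim/big_ind2: _ => [|????|]; [exact: adj0|exact: adjD|].
move=> -[[|n] /= _] _; first exact: adj1.
by rewrite -!/(altl g _ n.+1) -!/(altr g _ n.+1); apply: adjD; apply: adj_altl.
Qed.

(** When two families of words are biorthogonal, only the pairs made of twice the
    same word contribute to the product of the sums. Both labels denote the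
    empty word when [m = 0], whence the disjunction. *)
Lemma st_word_sum (w v : bool -> nat -> B) (y : bool -> C) N :
  (forall e, w e 0%N = 1) -> (forall e, v e 0%N = 1) ->
  (forall e m f k, phi (w e m * v f k) =
    ((m == k) && ((e == f) || (m == 0%N)))%:R * altl y e m) ->
  phi (word_sum w N * word_sum v N) = word_sum (altl y) N.
Proof.
move=> w0 v0 wv.
have layers m k : phi (layer w m * layer v k) = (m == k)%:R * layer (altl y) m.
  case: m k => [|m] [|k].
  - by rewrite /= -{1}(w0 true) -(v0 true) wv.
  - by rewrite /= mulrDr linearD -(w0 true) !wv /= !mul0r addr0.
  - by rewrite /= mulrDl linearD -(v0 true) !wv /= !mul0r addr0.
  rewrite /layer mulrDr !mulrDl !linearD !wv /= eqSS.
  by case: eqP => _ /=; rewrite ?mul1r !mul0r ?addr0 ?add0r.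
rewrite /word_sum mulr_suml linear_sum; apply: eq_bigr => m _.
rewrite mulr_sumr linear_sum (bigD1 m) //= layers eqxx mul1r big1 ?addr0 // => k km.
rewrite layers; suff /negPf -> : val m != val k by rewrite mul0r.
by rewrite val_eqE eq_sym.
Qed.

Definition centered (x : bool -> B) f : B := x f - phi (x f) *: 1.

End StarProbTheory.

(** * Free letters *)

(** The letters are normalized so that the state of [g b * g b] and the factor by
    which [g b] acts on a common fixed vector are the same number [x b]. *)
Section FreeLetters.
Variables (C : numClosedFieldType) (B : starProb C).
Local Notation phi := (@st C B).
Variables (g : bool -> B) (x : bool -> C).
Hypothesis g_sqr : forall b, g b * g b = x b *: 1 + (x b - 1) *: g b.
Hypothesis g_free : forall b m k, (0 < m + k)%N ->
  phi (altr g b m * altl g (~~ b) k) = 0.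

(** The square in the middle splits into a scalar, which shortens both words, and
    a multiple of the letter, which leaves an alternating word of state 0. *)
Lemma st_altr_altl e m f k : phi (altr g e m * altl g f k) =
  ((m == k) && ((e == f) || (m == 0%N)))%:R * altl x e m.
Proof.
elim: m e f k => [|m IHm] e f [|k].
- by rewrite /= orbT mul1r mulr1 st1.
- by have := g_free (~~ f) (isT : (0 < 0 + k.+1)%N); rewrite negbK mul0r => ->.
- by rewrite mul0r; apply: (g_free e (isT : (0 < m.+1 + 0)%N)).
rewrite eqSS orbF; have [<-|nef] := eqVneq e f; last first.
  have -> : f = ~~ e by case: e f nef => [] [].
  by rewrite g_free // andbF mul0r.
rewrite andbT /= -mulrA [g e * (g e * _)]mulrA g_sqr mulrDl mulrDr.
rewrite -!scalerAl -!scalerAr mul1r linearD !linearZ /= IHm.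
have -> : phi (altr g (~~ e) m * (g e * altl g (~~ e) k)) = 0.
  have : (0 < m + k.+1)%N by rewrite addnS.
  by move/(g_free (~~ e)); rewrite negbK.
by rewrite mulr0 addr0 eqxx /= andbT mulrCA.
Qed.

Lemma st_sum_sqr N :
  phi (word_sum (altl g) N * word_sum (altl g) N) = word_sum (altl x) N.
Proof. by rewrite {1}word_sum_lr; apply: st_word_sum st_altr_altl. Qed.

Lemma st_altr_word_sum e m N : (m < N)%N ->
  phi (altr g e m * word_sum (altl g) N) = altl x e m.
Proof.
move=> mN; rewrite /word_sum mulr_sumr linear_sum (bigD1 (Ordinal mN)) //=.
rewrite big1 ?addr0 => [|k km].
  case: m mN => [|m] mN; first by rewrite mulr1 st1.
  by rewrite mulrDr linearD !st_altr_altl eqxx /= !orbF;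
    case: e => /=; rewrite !mul0r mul1r ?addr0 ?add0r.
have {}km : m != k by rewrite eq_sym -val_eqE in km.
case: k km => [[|k] /= _] km.
  by rewrite -[LHS]/(phi (altr g e m * altl g true 0)) st_altr_altl (negPf km) mul0r.
by rewrite -!/(altl g _ k.+1) mulrDr linearD !st_altr_altl (negPf km) !mul0r addr0.
Qed.

(** Pairing with the sum of all alternating words is the character sending each
    [g b] to [x b]; a truncated sum computes it on all products that are
    shorter than the truncation. *)
Lemma st_prod_word_sum (s : seq bool) e m N : (m + size s < N)%N ->
  phi (altr g e m * ((\prod_(b <- s) (1 + g b)) * word_sum (altl g) N)) =
  altl x e m * \prod_(b <- s) (1 + x b).
Proof.
elim: s e m => [|b s IHs] e m /=.
  by rewrite addn0 !big_nil mul1r mulr1; apply: st_altr_word_sum.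
rewrite addnS -addSn => hN.
have hN' : (m + size s < N)%N by apply: ltn_trans hN; rewrite addSn.
rewrite !big_cons -!mulrA mulrA mulrDr mulr1.
set W := _ * word_sum _ _ in IHs *.
have [ebm|] := boolP ((m == 0%N) || (b != e)).
  have -> : altr g e m * g b = altr g b m.+1.
    move: ebm => /orP[/eqP -> //|be] /=.
    by congr (altr g _ m * _); case: b e be => [] [].
  have hx : altl x b m.+1 = altl x e m * x b.
    rewrite -!altr_com; move: ebm => /orP[/eqP -> //|be] /=.
    by congr (altr x _ m * _); case: b e be => [] [].
  by rewrite mulrDl linearD !IHs // hx; ring.
rewrite negb_or negbK => /andP[]; case: m hN hN' => // m hN hN' _ /eqP ->.
have -> : (altr g e m.+1 + altr g e m.+1 * g e) * W =
   x e *: (altr g (~~ e) m * W) + x e *: (altr g e m.+1 * W).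
  transitivity ((x e *: altr g (~~ e) m + x e *: altr g e m.+1) * W); last first.
    by rewrite [LHS]mulrDl -!scalerAl.
  congr (_ * W).
  rewrite /= -mulrA g_sqr mulrDr -!scalerAr mulr1 scalerBl scale1r.
  by rewrite addrCA [X in _ + X]addrC subrK.
rewrite linearD !linearZ /= -/(altr g e m.+1) !IHs //; last exact: ltn_trans hN'.
by rewrite -!altr_com /=; ring.
Qed.

Variable E : B.
Hypothesis E_idem : E * E = E.
Hypothesis gE : forall b, g b * E = x b *: E.
Hypothesis Eg : forall b, E * g b = x b *: E.

Lemma altl_meet b n : altl g b n * E = altl x b n *: E.
Proof.
elim: n b => [|n IHn] b /=; first by rewrite mul1r scale1r.
by rewrite -mulrA IHn -scalerAr gE scalerA mulrC.
Qed.

Lemma meet_altl b n : E * altl g b n = altl x b n *: E.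
Proof.
elim: n b => [|n IHn] b /=; first by rewrite mulr1 scale1r.
by rewrite mulrA Eg -scalerAl IHn scalerA.
Qed.

Lemma word_sum_meet N : word_sum (altl g) N * E = word_sum (altl x) N *: E.
Proof.
rewrite /word_sum mulr_suml scaler_suml; apply: eq_bigr => -[[|n] /= _] _.
  by rewrite mul1r scale1r.
by rewrite -!/(altl _ _ n.+1) mulrDl !altl_meet scalerDl.
Qed.

Lemma meet_word_sum N : E * word_sum (altl g) N = word_sum (altl x) N *: E.
Proof.
rewrite /word_sum mulr_sumr scaler_suml; apply: eq_bigr => -[[|n] /= _] _.
  by rewrite mulr1 scale1r.
by rewrite -!/(altl _ _ n.+1) mulrDr !meet_altl scalerDl.
Qed.

Lemma st_sub_word_sum_sqr c N :
  phi ((E - c *: word_sum (altl g) N) * (E - c *: word_sum (altl g) N)) =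
  phi E - 2 * c * phi E * word_sum (altl x) N + c ^+ 2 * word_sum (altl x) N.
Proof.
have -> : (E - c *: word_sum (altl g) N) * (E - c *: word_sum (altl g) N) =
  E - c *: (E * word_sum (altl g) N) - c *: (word_sum (altl g) N * E)
   + (c * c) *: (word_sum (altl g) N * word_sum (altl g) N).
  rewrite mulrBl !mulrBr -!scalerAl -!scalerAr E_idem scalerA.
  by rewrite opprB addrA addrAC.
rewrite word_sum_meet meet_word_sum stD !stB !stZ st_sum_sqr; ring.
Qed.

End FreeLetters.

(** * The meet of two free projections *)

Lemma conj_real_complex (R : realType) (x : R) : Num.conj (x%:C) = x%:C :> R[i].
Proof.
apply/CrealP; rewrite realE -[0]/((0 : R)%:C) !lecR -realE; exact: num_real.
Qed.

Lemma altl_scale (K : comNzRingType) (B : algType K) (k : bool -> K) (c : bool -> B) b n :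
  altl (fun b => k b *: c b) b n = altl k b n *: altl c b n.
Proof.
elim: n b => [|n IHn] b /=; first by rewrite scale1r.
by rewrite IHn -scalerAl -scalerAr scalerA.
Qed.

Lemma altr_scale (K : comNzRingType) (B : algType K) (k : bool -> K) (c : bool -> B) b n :
  altr (fun b => k b *: c b) b n = altr k b n *: altr c b n.
Proof.
elim: n b => [|n IHn] b /=; first by rewrite scale1r.
by rewrite IHn -scalerAl -scalerAr scalerA mulrC.
Qed.

(** What is retained of two free projections and of their meet [E] in a
    W*-probability space: [fm_meet_inf] is the form in which normality of the
    state is used, [E] being the infimum of the powers of
    [P true * P false * P true]. *)
Record free_meet (R : realType) (B : starProb R[i]) (P : bool -> B)
    (p : bool -> R) (E : B) : Prop := FreeMeet {
  fm_adj : forall b, adj (P b) (P b);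
  fm_idem : forall b, P b * P b = P b;
  fm_st : forall b, st B (P b) = (p b)%:C;
  fm_free : forall b m k, (0 < m + k)%N ->
    st B (altr (centered P) b m * altl (centered P) (~~ b) k) = 0;
  fm_meet_adj : adj E E;
  fm_meet_idem : E * E = E;
  fm_meet_l : forall b, P b * E = E;
  fm_meet_r : forall b, E * P b = E;
  fm_meet_inf : forall c : R,
    (forall m, c%:C <= st B ((P true * (P false * P true)) ^+ m *
                           (P true * (P false * P true)) ^+ m)) ->
    c%:C <= st B E }.

Section FreeProjections.
Variables (R : realType) (B : starProb R[i]).
Local Notation phi := (@st _ B).
Variables (P : bool -> B) (p : bool -> R) (E : B).
Hypothesis PEfree : free_meet P p E.
Let P_adj := fm_adj PEfree.
Let P_idem := fm_idem PEfree.
Let P_st := fm_st PEfree.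
Let P_free := fm_free PEfree.
Let E_adj := fm_meet_adj PEfree.
Let E_idem := fm_meet_idem PEfree.
Let PE := fm_meet_l PEfree.
Let EP := fm_meet_r PEfree.
Let E_inf := fm_meet_inf PEfree.
Let X := P true * (P false * P true).

Let e := complex.Re (phi E).

Lemma st_meetE : phi E = e%:C.
Proof. by rewrite RRe_real // st_sa_real. Qed.

Lemma st_meet_ge0 : 0 <= e.
Proof. by have := st_ge0 E_adj; rewrite E_idem st_meetE -[0]/(0%:C) lecR. Qed.

Lemma st_meet_le b : e <= p b.
Proof.
have := st_ge0 (adjB (P_adj b) E_adj).
rewrite mulrBr !mulrBl P_idem E_idem PE EP subrr subr0 stB P_st st_meetE.
by rewrite -rmorphB -[0]/(0%:C) lecR subr_ge0.
Qed.

Lemma st_proj_ge0 b : 0 <= p b.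
Proof. exact: le_trans st_meet_ge0 (st_meet_le b). Qed.

Lemma st_proj_le1 b : p b <= 1.
Proof.
have := st_ge0 (adjB (adj1 B) (P_adj b)).
rewrite mulrBr mulr1 mulrBl mul1r P_idem subrr subr0 stB st1 P_st.
by rewrite -[1]/(1%:C) -rmorphB -[0]/(0%:C) lecR subr_ge0.
Qed.

(** The centered projection, rescaled so as to multiply the meet by the odds
    against the projection. *)
Definition deviation b : B := (p b)^-1%:C *: P b - 1.
Let odds b := (1 - p b) / p b.
Let oddsC b := (odds b)%:C.

Lemma deviation_adj b : adj (deviation b) (deviation b).
Proof.
apply: adjB (adj1 B); rewrite -{2}[(_^-1)%:C]conj_real_complex.
exact: adjZ.
Qed.

Section Positive.
Hypothesis p_gt0 : forall b, 0 < p b.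

Let p_neq0 b : p b != 0. Proof. by rewrite gt_eqF. Qed.

Lemma deviation_centered : deviation = fun b => (p b)^-1%:C *: centered P b.
Proof.
apply/funext => b; rewrite /deviation /centered P_st scalerBr scalerA -rmorphM /=.
by rewrite mulVf // scale1r.
Qed.

Lemma odds_ge0 b : 0 <= odds b.
Proof. by rewrite divr_ge0 ?st_proj_ge0 // subr_ge0 st_proj_le1. Qed.

Lemma deviation_sqr b :
  deviation b * deviation b = oddsC b *: 1 + (oddsC b - 1) *: deviation b.
Proof.
set a := (p b)^-1%:C.
have -> : oddsC b = a - 1.
  by rewrite /oddsC /odds /a -(rmorph1 (real_complex R)) -rmorphB; congr (_%:C); field.
rewrite /deviation -/a; set u := a *: P b.
have uu : u * u = a *: u by rewrite /u -scalerAl -scalerAr P_idem.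
rewrite (scalerBr _ u) [RHS]addrCA -scalerBl subKr scale1r !scalerBl scale1r.
by rewrite mulrBr mulr1 mulrBl mul1r uu opprB addrA addrAC.
Qed.

Lemma deviation_free b m k : (0 < m + k)%N ->
  phi (altr deviation b m * altl deviation (~~ b) k) = 0.
Proof.
move=> mk; rewrite deviation_centered altr_scale altl_scale -scalerAl -scalerAr.
by rewrite !stZ P_free // !mulr0.
Qed.

Lemma deviation_meet b : deviation b * E = oddsC b *: E.
Proof.
rewrite /deviation mulrBl mul1r -scalerAl PE -{2}[E]scale1r -scalerBl /oddsC /odds.
by congr (_ *: _); rewrite -(rmorph1 (real_complex R)) -rmorphB; congr (_%:C); field.
Qed.

Lemma meet_deviation b : E * deviation b = oddsC b *: E.
Proof.
rewrite /deviation mulrBr mulr1 -scalerAr EP -{2}[E]scale1r -scalerBl /oddsC /odds.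
by congr (_ *: _); rewrite -(rmorph1 (real_complex R)) -rmorphB; congr (_%:C); field.
Qed.

Let eta N := word_sum (altl deviation) N.
Let s N := word_sum (altl odds) N.

Lemma word_sum_deviation_adj N : adj (eta N) (eta N).
Proof. exact/adj_word_sum/deviation_adj. Qed.

Lemma word_sum_oddsC N : word_sum (altl oddsC) N = (s N)%:C.
Proof. exact: (word_sum_rmorph (real_complex R)). Qed.

Lemma approx_adj N : adj (E - e%:C *: eta N) (E - e%:C *: eta N).
Proof.
apply: adjB => //; rewrite -{2}[e%:C]conj_real_complex.
exact/adjZ/word_sum_deviation_adj.
Qed.

(** The squared distance from [E] to [e *: eta N] in the norm given by [phi]. *)
Definition approx_err N : R := e - e ^+ 2 * s N.

Lemma st_approx_errE N :
  phi ((E - e%:C *: eta N) * (E - e%:C *: eta N)) = (approx_err N)%:C.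
Proof.
rewrite (st_sub_word_sum_sqr deviation_sqr deviation_free E_idem deviation_meet
  meet_deviation) word_sum_oddsC st_meetE.
rewrite -!rmorphXn -(rmorph_nat (real_complex R)) -!rmorphM -rmorphB -rmorphD.
by congr _%:C; rewrite /approx_err; ring.
Qed.

(** Bessel's inequality: the component of [E] along the span of the words of length
    less than [N] is [e *: eta N]. *)
Lemma st_meet_word_sum_le N : 0 < e -> e * s N <= 1.
Proof.
move=> e0; have := st_ge0 (approx_adj N); rewrite st_approx_errE.
rewrite -[0]/(0%:C) lecR /approx_err => h; rewrite -(ler_pM2l e0) mulr1; lra.
Qed.

(** [P b] is [p b] times [1 + deviation b], which the character represented by
    the word sum sends to [1 + odds b], the inverse of [p b]. *)
Lemma st_prod_proj_word_sum (l : seq bool) N : (size l < N)%N ->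
  phi ((\prod_(b <- l) P b) * eta N) = 1.
Proof.
move=> lN; have PE_ b : P b = (p b)%:C *: (1 + deviation b).
  rewrite /deviation addrC subrK scalerA -rmorphM /= mulfV //.
  by rewrite rmorph1 scale1r.
have -> : \prod_(b <- l) P b = (\prod_(b <- l) (p b)%:C) *: \prod_(b <- l) (1 + deviation b).
  elim: l {lN} => [|b l IHl]; first by rewrite !big_nil scale1r.
  by rewrite !big_cons IHl {1}PE_ -scalerAl -scalerAr scalerA.
rewrite -scalerAl stZ.
have := st_prod_word_sum deviation_sqr deviation_free (true) (m := 0) lN.
rewrite /= !mul1r => ->; rewrite -big_split /= big1 // => b _.
rewrite /oddsC /odds -(rmorph1 (real_complex R)) -rmorphD -rmorphM.
by congr (_%:C); field.
Qed.

Lemma compression_exp_prod m :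
  X ^+ m = \prod_(b <- flatten (nseq m [:: true; false; true])) P b.
Proof.
elim: m => [|m IHm]; first by rewrite big_nil.
by rewrite exprS IHm /= !big_cons /X !mulrA.
Qed.

Lemma compression_exp_adj m : adj (X ^+ m) (X ^+ m).
Proof.
have hX : adj X X by rewrite {2}/X mulrA; do 2!apply: adjM => //.
elim: m => [|m IHm]; first exact: adj1.
by rewrite {1}exprSr exprS; apply: adjM.
Qed.

(** Cauchy-Schwarz for a power of the compression and the word sum, whose inner
    product is exactly 1 once the truncation is long enough. *)
Lemma st_compression_exp_ge c m : 0 <= c -> (forall N, c * s N <= 1) ->
  c%:C <= phi (X ^+ m * X ^+ m).
Proof.
move=> c0 hc; pose N := (size (flatten (nseq m [:: true; false; true]))).+1.
have Xeta : phi (X ^+ m * eta N) = 1 by rewrite compression_exp_prod st_prod_proj_word_sum.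
have etaX : phi (eta N * X ^+ m) = 1.
  by rewrite (st_conj_mul (compression_exp_adj m) (word_sum_deviation_adj N)) Xeta conjC1.
have h : adj (X ^+ m - c%:C *: eta N) (X ^+ m - c%:C *: eta N).
  apply: adjB (compression_exp_adj m) _; rewrite -{2}[c%:C]conj_real_complex.
  exact/adjZ/word_sum_deviation_adj.
have := st_ge0 h.
have -> : (X ^+ m - c%:C *: eta N) * (X ^+ m - c%:C *: eta N) =
    X ^+ m * X ^+ m - c%:C *: (X ^+ m * eta N) - c%:C *: (eta N * X ^+ m)
    + (c%:C * c%:C) *: (eta N * eta N).
  rewrite mulrBl !mulrBr -!scalerAl -!scalerAr scalerA.
  by rewrite opprB addrA addrAC.
rewrite stD !stB !stZ Xeta etaX !mulr1.
rewrite (st_sum_sqr deviation_sqr deviation_free) word_sum_oddsC => h1.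
rewrite -subr_ge0; apply: le_trans h1 _.
rewrite -[leRHS]addr0 -addrA lerD2l -rmorphM -rmorphM -rmorphN -rmorphD -[0]/(0%:C) lecR.
have := ler_wpM2l c0 (hc N); lra.
Qed.

Lemma addr1_odds b : 1 + odds b = (p b)^-1.
Proof. by rewrite /odds; field. Qed.

Lemma subr1_odds : 1 - odds true * odds false = (p true + p false - 1) / (p true * p false).
Proof. by rewrite /odds; field; rewrite !p_neq0. Qed.

Lemma word_sum_odds_lim :
  (1 + odds true) * (1 + odds false) / (1 - odds true * odds false) =
  (p true + p false - 1)^-1.
Proof.
by rewrite subr1_odds !addr1_odds -invfM invf_div mulrA mulVf ?mul1r // mulf_neq0.
Qed.

(** The squared norm of the word sum stays bounded exactly when the product of the
    two odds is less than 1, that is when [p true + p false > 1]; it then tends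
    to the inverse of [p true + p false - 1]. Bessel's inequality bounds [e]
    from above and the powers of the compression bound it from below. *)
Lemma meet_value_pos : e = Num.max (p true + p false - 1) 0.
Proof.
have pp : 0 < p true * p false by rewrite mulr_gt0.
have [z1|z1] := ltP (odds true * odds false) 1.
  have pp1 : 0 < p true + p false - 1.
    by rewrite -subr_gt0 in z1; rewrite subr1_odds pmulr_lgt0 ?invr_gt0 in z1.
  rewrite max_l; last exact: ltW.
  have hN N := word_sum_le N odds_ge0 z1.
  have le1 : p true + p false - 1 <= e.
    rewrite -lecR -st_meetE; apply: E_inf => m; apply: st_compression_exp_ge => [|N].
      exact: ltW.
    by rewrite -ler_pdivlMl // mulr1 -word_sum_odds_lim.
  apply/eqP; rewrite eq_le le1 andbT.
  have e0 : 0 < e := lt_le_trans pp1 le1.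
  have [_] := word_sum_bounded odds_ge0 e0 (fun N => st_meet_word_sum_le N e0).
  by rewrite subr1_odds !addr1_odds -invfM ler_pdivrMr // divfK // gt_eqF.
rewrite max_r; last first.
  by move: z1; rewrite -subr_le0 subr1_odds pmulr_lle0 // invr_gt0.
apply/eqP; rewrite eq_le st_meet_ge0 andbT leNgt; apply/negP => e0.
have [] := word_sum_bounded odds_ge0 e0 (fun N => st_meet_word_sum_le N e0).
by rewrite ltNge z1.
Qed.

(** If [e > 0] then [E] is [e] times the full word sum: there is equality in
    Bessel's inequality in the limit. *)
Lemma approx_err_cvg : 0 < e -> (fun K => approx_err K.*2) @ \oo --> (0 : R).
Proof.
move=> e0; have [z1 _] := word_sum_bounded odds_ge0 e0 (fun N => st_meet_word_sum_le N e0).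
have -> : 0 = e - e ^+ 2 * ((1 + odds true) * (1 + odds false) / (1 - odds true * odds false)).
  have eE : e = p true + p false - 1.
    have := meet_value_pos; case: (leP (p true + p false - 1) 0) => // _ h.
    by rewrite h ltxx in e0.
  by rewrite word_sum_odds_lim -eE expr2 mulfK ?subrr // gt_eqF.
apply: cvgB; first exact: cvg_cst.
apply: cvgM; first exact: cvg_cst.
exact: cvg_word_sum odds_ge0 z1.
Qed.

End Positive.

Lemma meet_value : phi E = (Num.max (p true + p false - 1) 0)%:C.
Proof.
rewrite st_meetE; congr (_%:C).
have [p0|] := boolP [forall b, 0 < p b].
  by apply: meet_value_pos => b; exact: (forallP p0).
rewrite negb_forall => /existsP[b]; rewrite -leNgt => pb.
have pb0 : p b = 0 by apply/eqP; rewrite eq_le pb st_proj_ge0.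
have -> : e = 0 by apply/eqP; rewrite eq_le st_meet_ge0 andbT -pb0 st_meet_le.
rewrite max_r // subr_le0.
by case: b pb0 {pb} => ->; rewrite ?add0r ?addr0 st_proj_le1.
Qed.

End FreeProjections.

(** * The meets of two bi-free pairs of projections *)

Lemma altlM (S : comPzSemiRingType) (x y : bool -> S) b n :
  altl (fun b => x b * y b) b n = altl x b n * altl y b n.
Proof. by elim: n b => [|n IHn] b /=; rewrite ?mulr1 // IHn mulrACA. Qed.

Section BiFreeMeets.
Variables (R : realType) (B : starProb R[i]).
Local Notation phi := (@st _ B).
Variables (P Q : bool -> B) (p q r : bool -> R) (E F : B).
Hypothesis PEfree : free_meet P p E.
Hypothesis QFfree : free_meet Q q F.
Hypothesis PQ_st : forall b, phi (P b * Q b) = (r b)%:C.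
Hypothesis PQ_bifree : forall e m f k,
  phi (altr (centered P) e m * altr (centered Q) f k) =
  ((m == k) && ((e == f) || (m == 0%N)))%:R *
    altl (fun b => phi (P b * Q b) - phi (P b) * phi (Q b)) e m.
Hypothesis PQ_com : forall b, P b * Q b = Q b * P b.
Hypothesis EQ_com : forall b, E * Q b = Q b * E.
Hypothesis EF_com : E * F = F * E.

Let E_adj := fm_meet_adj PEfree.
Let F_adj := fm_meet_adj QFfree.

Lemma st_projection_le1 (G : B) : adj G G -> G * G = G -> phi (G * G) <= 1.
Proof.
move=> hG GG; have := st_ge0 (adjB (adj1 B) hG).
by rewrite mulrBr mulr1 mulrBl mul1r GG subrr subr0 stB st1 subr_ge0.
Qed.

Lemma st_eq0_of_sqr (z c : R[i]) : `|z| ^+ 2 <= c -> c = 0 -> z = 0.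
Proof.
move=> zc c0; apply/eqP; rewrite -normr_eq0 -sqrf_eq0 eq_le -{1}c0 zc.
by rewrite exprn_ge0.
Qed.

Lemma st_meets_eq0l : phi E = 0 -> phi (E * F) = 0.
Proof.
move=> E0; have FF1 := st_projection_le1 F_adj (fm_meet_idem QFfree).
by apply: st_eq0_of_sqr (st_CS_left E_adj F_adj FF1) _; rewrite (fm_meet_idem PEfree).
Qed.

Lemma st_meets_eq0r : phi F = 0 -> phi (E * F) = 0.
Proof.
move=> F0; have EE1 := st_projection_le1 E_adj (fm_meet_idem PEfree).
by apply: st_eq0_of_sqr (st_CS_right E_adj F_adj EE1) _; rewrite (fm_meet_idem QFfree).
Qed.

Lemma meets_idem : (E * F) * (E * F) = E * F.
Proof.
rewrite {1}EF_com -mulrA [E * (E * F)]mulrA (fm_meet_idem PEfree) EF_com mulrA.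
by rewrite (fm_meet_idem QFfree).
Qed.

Lemma meets_adj : adj (E * F) (E * F).
Proof. by rewrite {2}EF_com; apply: adjM. Qed.

(** As [E] commutes with [Q b], the product [E * F] is fixed by [P b * Q b]. *)
Lemma st_meets_eq0 b : phi (P b * Q b) = 0 -> phi (E * F) = 0.
Proof.
move=> PQ0; have EFE : (P b * Q b) * (E * F) = E * F.
  by rewrite -mulrA [Q b * _]mulrA -EQ_com -!mulrA (fm_meet_l QFfree) mulrA (fm_meet_l PEfree).
have PQ_adj : adj (P b * Q b) (P b * Q b).
  by rewrite {2}PQ_com; apply: adjM; [apply: fm_adj PEfree _|apply: fm_adj QFfree _].
have EF1 := st_projection_le1 meets_adj meets_idem.
rewrite -EFE; apply: st_eq0_of_sqr (st_CS_left PQ_adj meets_adj EF1) _.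
rewrite -PQ0 {1}PQ_com -!mulrA [P b * (P b * _)]mulrA (fm_idem PEfree).
by rewrite PQ_com mulrA (fm_idem QFfree).
Qed.

Section Positive.
Hypothesis E_gt0 : 0 < phi E.
Hypothesis F_gt0 : 0 < phi F.
Let e := complex.Re (phi E).
Let f := complex.Re (phi F).

Lemma re_st_E_gt0 : 0 < e.
Proof. by have := E_gt0; rewrite (st_meetE PEfree) -[0]/(0%:C) ltcR. Qed.

Lemma re_st_F_gt0 : 0 < f.
Proof. by have := F_gt0; rewrite (st_meetE QFfree) -[0]/(0%:C) ltcR. Qed.

Lemma p_gt0 b : 0 < p b.
Proof. exact: lt_le_trans re_st_E_gt0 (st_meet_le PEfree b). Qed.

Lemma q_gt0 b : 0 < q b.
Proof. exact: lt_le_trans re_st_F_gt0 (st_meet_le QFfree b). Qed.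

Let y b := (r b - p b * q b) / (p b * q b).
Let eta N := word_sum (altl (deviation P p)) N.
Let zeta N := word_sum (altl (deviation Q q)) N.

(** A left word pairs only with the right word having the same labels, each label
    contributing the normalized covariance [y b]. *)
Lemma st_word_sums N : phi (eta N * zeta N) = (word_sum (altl y) N)%:C.
Proof.
rewrite /eta /zeta {1}word_sum_lr [in X in _ * X]word_sum_lr.
rewrite -(word_sum_rmorph (real_complex R)).
apply: st_word_sum => // k m l n.
rewrite (deviation_centered PEfree p_gt0) (deviation_centered QFfree q_gt0) !altr_scale.
rewrite -scalerAl -scalerAr !stZ PQ_bifree.
have [<-{n}|_] /= := eqVneq m n; last by rewrite !mul0r !mulr0.
have [kl|] := boolP ((k == l) || (m == 0%N)); last by rewrite !mul0r !mulr0.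
rewrite !mul1r.
have -> : altr (fun b => (q b)^-1%:C) l m = altr (fun b => (q b)^-1%:C) k m.
  by move: kl => /orP[/eqP -> //|/eqP ->].
rewrite !altr_com mulrA -!altlM; congr (altl _ _ _); apply/funext => b.
rewrite PQ_st (fm_st PEfree) (fm_st QFfree) -!rmorphM -rmorphB -rmorphM.
by congr (_%:C); rewrite /y invfM; ring.
Qed.

(** Replace [E] and then [F] by their approximations; each replacement costs the
    distance, the other factor having norm at most 1. *)
Lemma st_meets_approx N :
  `|phi (E * F) - (e * f * word_sum (altl y) N)%:C| <=
  (Num.sqrt (approx_err p E N) + Num.sqrt (approx_err q F N))%:C.
Proof.
have -> : phi (E * F) - (e * f * word_sum (altl y) N)%:C =
  phi ((E - e%:C *: eta N) * F) + phi ((e%:C *: eta N) * (F - f%:C *: zeta N)).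
  rewrite -stD mulrBl mulrBr addrA subrK stB; congr (_ - _).
  have -> : (e%:C *: eta N) * (f%:C *: zeta N) = (e%:C * f%:C) *: (eta N * zeta N).
    by rewrite -scalerAl -scalerAr scalerA.
  by rewrite stZ st_word_sums -!rmorphM.
have sq (z : R[i]) (d : R) : `|z| ^+ 2 <= d%:C -> `|z| <= (Num.sqrt d)%:C.
  move=> zd; have d0 : 0 <= d.
    by rewrite -lecR (le_trans _ zd) // exprn_ge0.
  rewrite -(@ler_pXn2r _ 2) // ?nnegrE ?normr_ge0 -?[0]/(0%:C) ?lecR ?sqrtr_ge0 //.
  suff -> : (Num.sqrt d)%:C ^+ 2 = d%:C by [].
  by rewrite -[in RHS](sqr_sqrtr d0) rmorphXn.
rewrite rmorphD; apply: le_trans (ler_normD _ _) (lerD _ _); apply: sq.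
  rewrite -(st_approx_errE PEfree p_gt0).
  apply: st_CS_left (approx_adj PEfree N) F_adj _.
  exact: st_projection_le1 F_adj (fm_meet_idem QFfree).
rewrite -(st_approx_errE QFfree q_gt0).
have ea : adj (e%:C *: eta N) (e%:C *: eta N).
  rewrite -{2}[e%:C]conj_real_complex; exact/adjZ/(word_sum_deviation_adj PEfree).
apply: st_CS_right ea (approx_adj QFfree N) _.
rewrite -scalerAl -scalerAr !stZ.
rewrite (st_sum_sqr (deviation_sqr PEfree p_gt0) (deviation_free PEfree p_gt0)).
rewrite word_sum_oddsC -!rmorphM -(rmorph1 (real_complex R)) lecR.
have h := st_meet_word_sum_le PEfree p_gt0 N re_st_E_gt0.
apply: le_trans (_ : e * 1 <= 1); first by rewrite ler_pM2l // re_st_E_gt0.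
by rewrite mulr1 (le_trans (st_meet_le PEfree true)) // (st_proj_le1 PEfree).
Qed.

Lemma cvg_word_sum_st_meets :
  (fun K => word_sum (altl y) K.*2) @ \oo --> complex.Re (phi (E * F)) / (e * f).
Proof.
have efn : e * f != 0 by rewrite mulf_neq0 // gt_eqF // ?re_st_E_gt0 ?re_st_F_gt0.
have -> : (fun K => word_sum (altl y) K.*2) =
    (fun K => e * f * word_sum (altl y) K.*2 / (e * f)).
  by apply/funext => K; rewrite mulrAC mulfV ?mul1r.
apply: cvgM; last exact: cvg_cst.
have sqrt0 (u : nat -> R) : u @ \oo --> (0 : R) ->
    (fun K => Num.sqrt (u K)) @ \oo --> (0 : R).
  move=> u0; rewrite -[X in _ --> X](@sqrtr0 R).
  by apply: cvg_comp u0 _; apply: sqrt_continuous.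
have d0 : (fun K => Num.sqrt (approx_err p E K.*2) + Num.sqrt (approx_err q F K.*2))
    @ \oo --> (0 : R).
  rewrite -[X in _ --> X]addr0; apply: cvgD; apply: sqrt0.
    exact: approx_err_cvg PEfree p_gt0 re_st_E_gt0.
  exact: approx_err_cvg QFfree q_gt0 re_st_F_gt0.
have c0 : (fun _ : nat => 0 : R) @ \oo --> (0 : R) by apply: cvg_cst.
apply/subr_cvg0; apply: norm_cvg0; apply: (squeeze_cvgr _ c0 d0).
near=> K; rewrite normr_ge0 /= -lecR distrC.
apply: le_trans (st_meets_approx K.*2); apply: le_trans (normc_ge_Re _).
by rewrite raddfB.
Unshelve. all: by end_near. Qed.

(** The limit of the word sums of [y] is
    [(1 + y true) (1 + y false) / (1 - y true * y false)], whose inverse is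
    [1 / (1 + y true) + 1 / (1 + y false) - 1]. *)
Lemma st_meets_value : (forall b, 0 < phi (P b * Q b)) ->
  phi (E * F) != 0 /\
  phi E * phi F / phi (E * F) =
  phi (P true) * phi (Q true) / phi (P true * Q true) +
  phi (P false) * phi (Q false) / phi (P false * Q false) - 1.
Proof.
move=> PQ0; have r0 b : 0 < r b by have := PQ0 b; rewrite PQ_st -[0]/(0%:C) ltcR.
have y1 b : 1 + y b = r b / (p b * q b).
  by rewrite /y; field; rewrite !gt_eqF ?p_gt0 ?q_gt0.
have y1_gt0 b : 0 < 1 + y b by rewrite y1 divr_gt0 // mulr_gt0 ?p_gt0 ?q_gt0.
have nz : 2 + y true + y false != 0.
  have -> : 2 + y true + y false = (1 + y true) + (1 + y false) by ring.
  by rewrite gt_eqF // addr_gt0.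
have := word_sum_cvg_val nz cvg_word_sum_st_meets.
rewrite (st_meetE PEfree) (st_meetE QFfree) !PQ_st !(fm_st PEfree) !(fm_st QFfree).
rewrite -[phi (E * F)]RRe_real ?(st_sa_real meets_adj) // -/e -/f.
set rho := complex.Re (phi (E * F)) => hval.
have ef0 : e * f != 0 by rewrite mulf_neq0 // gt_eqF // ?re_st_E_gt0 ?re_st_F_gt0.
have rho0 : rho != 0.
  apply/eqP => rho0; move: hval; rewrite rho0 !mul0r => /esym/eqP.
  by rewrite mulf_eq0 !gt_eqF.
split; first by rewrite -(rmorph0 (real_complex R)) (inj_eq (@complexI R)).
rewrite -!rmorphM -!fmorphV -!rmorphM -rmorphD -(rmorph1 (real_complex R)) -rmorphB.
congr (_%:C).
have z0 : 1 - y true * y false != 0.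
  apply/eqP => z0; move: hval; rewrite z0 mulr0 => /esym/eqP.
  by rewrite mulf_eq0 !gt_eqF.
have -> : e * f / rho = (1 - y true * y false) / ((1 + y true) * (1 + y false)).
  by rewrite -hval invfM mulrCA mulfV // mulr1 invf_div.
have -> : 1 - y true * y false = (1 + y true) + (1 + y false) - (1 + y true) * (1 + y false).
  by ring.
rewrite !y1; have [rt rf] := (r0 true, r0 false).
have [pt pf] := (p_gt0 true, p_gt0 false).
have [qt qf] := (q_gt0 true, q_gt0 false).
by field; rewrite !gt_eqF.
Qed.

End Positive.
End BiFreeMeets.

(** * Alternating operators on a free product *)

Section AlternatingOperators.
Variables (K : fieldType) (V : bool -> lmodType K).
Local Notation letter := {i : bool & V i}.
Local Notation fp := (free_prod V).
Local Notation alternating := Defs.alternating.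
Local Notation vac := (@vacuum_coef K V).

Lemma alternating_cons i j (s : seq bool) :
  alternating [:: i, j & s] = (i != j) && alternating (j :: s).
Proof. by []. Qed.

Lemma negb_neq b : ~~ b != b. Proof. by case: b. Qed.

Fixpoint alt_word (x : forall i, V i) b n : seq letter :=
  if n is n'.+1 then Tagged V (x b) :: alt_word x (~~ b) n' else [::].

Lemma alternating_alt_word x b n : alternating (~~ b :: labels (alt_word x b n)).
Proof.
elim: n b => [//|n IHn] b; have := IHn (~~ b); rewrite negbK => alt.
by apply/andP; split=> //; apply: negb_neq.
Qed.

Fixpoint altr_op (o : bool -> fp -> fp) b n : fp -> fp :=
  if n is n'.+1 then altr_op o (~~ b) n' \o o b else id.

Fixpoint altl_op (o : bool -> fp -> fp) b n : fp -> fp :=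
  if n is n'.+1 then o b \o altl_op o (~~ b) n' else id.

Lemma altr_op_linear (o : bool -> fp -> fp) b n :
  (forall i, linear (o i)) -> linear (altr_op o b n).
Proof. by move=> lo; elim: n b => //= n IHn b a u v /=; rewrite lo IHn. Qed.

(** The hypotheses describe centered left operators with [W w] the word [w], and
    centered right operators with [W w] the reversed word, so that both faces
    are treated at once. *)
Section Creation.
Variables (o : bool -> fp -> fp) (W : seq letter -> fp) (x : forall i, V i).
Hypothesis W_vac : forall w, vac (W w) = (w == [::])%:R.
Hypothesis o_create : forall i w, alternating (i :: labels w) ->
  o i (W w) = W (Tagged V (x i) :: w).

Lemma altl_op_create b n : altl_op o b n (W [::]) = W (alt_word x b n).
Proof.
elim: n b => [//|n IHn] b /=; rewrite IHn o_create //.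
by have := alternating_alt_word x (~~ b) n; rewrite negbK.
Qed.

(** Each operator meets a word that does not begin with its own label, and
    prepends a letter: no word ever becomes shorter. *)
Lemma vac_altr_op_create b n w : alternating (b :: labels w) -> (0 < n + size w)%N ->
  vac (altr_op o b n (W w)) = 0.
Proof.
elim: n b w => [|n IHn] b w alt hn; first by rewrite W_vac; case: w hn {alt}.
rewrite /= o_create // IHn //; last by rewrite addnS.
by apply/andP; split=> //; apply: negb_neq.
Qed.

Lemma vac_alternating b m k : (0 < m + k)%N ->
  vac (altr_op o b m (altl_op o (~~ b) k (W [::]))) = 0.
Proof.
move=> mk; rewrite altl_op_create vac_altr_op_create //.
  by have := alternating_alt_word x (~~ b) k; rewrite negbK.
by case: k mk => [|k] /= mk; rewrite ?addnS // addn0 in mk *.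
Qed.

End Creation.

Section Pairing.
Variables (l r : bool -> fp -> fp) (s t : forall i, V i) (d : bool -> K).
Hypothesis l_linear : forall i, linear (l i).
Hypothesis l_create : forall i w, alternating (i :: labels w) ->
  l i (fp_word w) = fp_word (Tagged V (s i) :: w).
Hypothesis l_pair : forall i w, alternating (i :: labels w) ->
  exists y : V i, l i (fp_word (Tagged V (t i) :: w)) =
    d i *: fp_word w + fp_word (Tagged V y :: w).
Hypothesis r_create : forall i w, alternating (rcons (labels w) i) ->
  r i (fp_word w) = fp_word (rcons w (Tagged V (t i))).

Lemma alternating_rcons2 i (u : seq bool) :
  alternating (rcons u i) -> alternating (rcons (rcons u i) (~~ i)).
Proof.
rewrite -!(alternating_rev (rcons _ _)) !rev_rcons alternating_cons => ->.
by case: i.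
Qed.

(** Right operators append their letters in the order in which they act, the last
    label of the product first. *)
Lemma altr_op_append f k u : alternating (rcons (labels u) f) ->
  altr_op r f k (fp_word u) = fp_word (u ++ alt_word t f k).
Proof.
elim: k f u => [|k IHk] f u alt; first by rewrite cats0.
rewrite /= r_create // IHk ?cat_rcons // /labels map_rcons.
exact: alternating_rcons2.
Qed.

(** The rightmost left operator meets the letter created by the rightmost right
    operator. With equal labels the result is [d] times the word without
    that letter plus a word in which the letter is replaced; after a replacement, or with distinct labels, the word
    only grows. *)
Lemma vac_altr_op_pair e m f k :
  vac (altr_op l e m (altr_op r f k (fp_vacuum V))) =
  ((m == k) && ((e == f) || (m == 0%N)))%:R * altl d e m.
Proof.
rewrite altr_op_append //; elim: m e f k => [|m IHm] e f k.
  by rewrite vacuum_coef_word orbT andbT mulr1; case: k.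
case: k => [|k].
  by rewrite (vac_altr_op_create (@vacuum_coef_word K V) l_create) // mul0r.
have [<-{f}|ef] := eqVneq e f; last first.
  rewrite (vac_altr_op_create (@vacuum_coef_word K V) l_create) ?andbF ?mul0r //.
    by have := alternating_alt_word t f k.+1; case: e f ef => [] [].
have alt : alternating (e :: labels (alt_word t (~~ e) k)).
  by have := alternating_alt_word t (~~ e) k; rewrite negbK.
have [y /= ->] := l_pair alt.
rewrite altr_op_linear // vacuum_coef_linear.
rewrite [X in _ + X](vac_altr_op_create (@vacuum_coef_word K V) l_create) ?addnS //; last first.
  by apply/andP; split=> //; apply: negb_neq.
by rewrite addr0 IHm !eqxx eqSS /= !andbT -[LHS]/(d e * _) mulrCA.
Qed.

End Pairing.
End AlternatingOperators.

(** * Moments of bi-free pairs *)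

Section BiFreeModel.
Variables (C : numClosedFieldType) (B : starProb C) (V : bool -> lmodType C).
Variables (S T : forall i, pointed V i -> pointed V i).
Hypothesis S_linear : forall i, linear (@S i).
Hypothesis T_linear : forall i, linear (@T i).
Variables (P Q : bool -> B).
Local Notation phi := (@st _ B).
Local Notation fp := (free_prod V).
Local Notation alternating := Defs.alternating.
Local Notation vac := (@vacuum_coef C V).
Local Notation xi := (fp_vacuum V).

Definition sp_monomial (s : seq (bool * bool)) : B :=
  foldr (fun k b => (if k.2 then P k.1 else Q k.1) * b) 1 s.

Let lam i := lambda_op (@S i).
Let rho i := rho_op (@T i).
Let op_monomial := monomial (fun i => (lam i, rho i)).

Hypothesis model : forall s, phi (sp_monomial s) = vacuum_state (op_monomial s).

Let lamP i : is_lambda (@S i) (lam i) := lambdaP (@S_linear i).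
Let rhoP i : is_rho (@T i) (rho i) := rhoP (@T_linear i).

(** An element and an operator are related when they are the same noncommutative
    polynomial, the one in the projections and the other in the operators of the
    model. Equality of all the moments thus extends from monomials to
    polynomials. *)
Inductive modeled : B -> (fp -> fp) -> Prop :=
| modeled_monomial s : modeled (sp_monomial s) (op_monomial s)
| modeled_lin c a b M N : modeled a M -> modeled b N ->
    modeled (c *: a + b) (fun v => c *: M v + N v).

Lemma op_monomial_linear s : linear (op_monomial s).
Proof.
elim: s => [//|[i j] s IHs] c u v /=; rewrite IHs.
by case: j; [case: (lamP i) => -> | case: (rhoP i) => ->].
Qed.

Lemma modeled_linear a M : modeled a M -> linear M.
Proof.
elim=> [s|c {}a b {}M N _ lM _ lN]; first exact: op_monomial_linear.
by move=> d u v; rewrite lM lN !scalerDr !scalerA mulrC addrACA.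
Qed.

Lemma modeled_st a M : modeled a M -> phi a = vac (M xi).
Proof.
elim=> [s|c {}a b {}M N _ aM _ bN]; first exact: model.
by rewrite stD stZ aM bN vacuum_coef_linear.
Qed.

Lemma modeledM a b M N : modeled a M -> modeled b N -> modeled (a * b) (M \o N).
Proof.
move=> aM; elim=> [s|c b1 b2 N1 N2 _ IH1 _ IH2]; last first.
  have -> : M \o (fun v => c *: N1 v + N2 v) = (fun v => c *: (M \o N1) v + (M \o N2) v).
    by apply/funext => v /=; rewrite (modeled_linear aM).
  by rewrite mulrDr -scalerAr; apply: modeled_lin.
elim: aM => [r|c a1 a2 M1 M2 _ IH1 _ IH2].
  have -> : sp_monomial r * sp_monomial s = sp_monomial (r ++ s).
    by elim: r => [|k r IHr] /=; rewrite ?mul1r // -mulrA IHr.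
  have -> : op_monomial r \o op_monomial s = op_monomial (r ++ s).
    by rewrite /op_monomial; elim: r => //= k r <-.
  exact: modeled_monomial.
by rewrite mulrDl -scalerAl; apply: modeled_lin.
Qed.

Lemma modeled1 : modeled 1 id.
Proof. exact: (modeled_monomial [::]). Qed.

Definition centered_op (x : bool -> B) (o : bool -> fp -> fp) b (v : fp) : fp :=
  o b v - phi (x b) *: v.

Lemma modeled_centered x o b : modeled (x b) (o b) ->
  modeled (centered x b) (centered_op x o b).
Proof.
move=> xo; have := modeled_lin (- phi (x b)) modeled1 xo.
rewrite scaleNr addrC /centered; congr modeled.
by apply/funext => v; rewrite /centered_op scaleNr addrC.
Qed.

Lemma modeled_lam b : modeled (P b) (lam b).
Proof. by have := modeled_monomial [:: (b, true)]; rewrite /= mulr1. Qed.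

Lemma modeled_rho b : modeled (Q b) (rho b).
Proof. by have := modeled_monomial [:: (b, false)]; rewrite /= mulr1. Qed.

Lemma modeled_altl x o b n : (forall b, modeled (x b) (o b)) ->
  modeled (altl x b n) (altl_op o b n).
Proof.
by move=> xo; elim: n b => [|n IHn] b; [exact: modeled1 | exact: modeledM].
Qed.

Lemma modeled_altr x o b n : (forall b, modeled (x b) (o b)) ->
  modeled (altr x b n) (altr_op o b n).
Proof.
by move=> xo; elim: n b => [|n IHn] b; [exact: modeled1 | exact: modeledM].
Qed.

Let cP := centered P.
Let cQ := centered Q.
Let clam := centered_op P lam.
Let crho := centered_op Q rho.

Let modeled_cP b : modeled (cP b) (clam b) := modeled_centered (modeled_lam b).
Let modeled_cQ b : modeled (cQ b) (crho b) := modeled_centered (modeled_rho b).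

Let s i : V i := (@S i (1, 0)).2.
Let t i : V i := (@T i (1, 0)).2.

Lemma fp_word0l i w : fp_word (Tagged V (0 : V i) :: w) = 0.
Proof.
have := fp_word_lin [::] (1 : C) (0 : V i) 0 w.
by rewrite /= scale1r addr0 scale1r => /esym/eqP; rewrite -subr_eq0 addrK => /eqP.
Qed.

Lemma fp_word0r i w : fp_word (rcons w (Tagged V (0 : V i))) = 0.
Proof.
have := fp_word_lin w (1 : C) (0 : V i) 0 [::].
by rewrite -cats1 /= scale1r addr0 scale1r => /esym/eqP; rewrite -subr_eq0 addrK => /eqP.
Qed.

Lemma concat_l1 i w : concat_l ((1, 0) : pointed V i) w = fp_word w.
Proof. by rewrite /concat_l /= fp_word0l addr0 scale1r. Qed.

Lemma concat_r1 i w : concat_r w ((1, 0) : pointed V i) = fp_word w.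
Proof. by rewrite /concat_r /= fp_word0r addr0 scale1r. Qed.

Lemma vac_concat_l i (z : pointed V i) : vac (concat_l z [::]) = z.1.
Proof.
by rewrite /concat_l vacuum_coef_linear !vacuum_coef_word /= addr0; apply: mulr1.
Qed.

Lemma vac_concat_r i (z : pointed V i) : vac (concat_r [::] z) = z.1.
Proof.
by rewrite /concat_r vacuum_coef_linear !vacuum_coef_word /= addr0; apply: mulr1.
Qed.

Lemma st_P i : phi (P i) = (@S i (1, 0)).1.
Proof.
rewrite (modeled_st (modeled_lam i)) /fp_vacuum -(concat_l1 i) (lamP i).2 //.
exact: vac_concat_l.
Qed.

Lemma st_Q i : phi (Q i) = (@T i (1, 0)).1.
Proof.
rewrite (modeled_st (modeled_rho i)) /fp_vacuum -(concat_r1 i) (rhoP i).2 //.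
exact: vac_concat_r.
Qed.

Lemma clam_create i w : alternating (i :: labels w) ->
  clam i (fp_word w) = fp_word (Tagged V (s i) :: w).
Proof.
move=> alt; rewrite /clam /centered_op -{1}(concat_l1 i) (lamP i).2 // st_P.
by rewrite /concat_l addrAC subrr add0r.
Qed.

Lemma crho_create i w : alternating (rcons (labels w) i) ->
  crho i (fp_word w) = fp_word (rcons w (Tagged V (t i))).
Proof.
move=> alt; rewrite /crho /centered_op -{1}(concat_r1 i) (rhoP i).2 // st_Q.
by rewrite /concat_r addrAC subrr add0r.
Qed.

Let d i := (@S i (0, t i)).1.

(** [S] maps [t] to a multiple [d] of the distinguished vector plus a vector of
    [V i]; centering only changes the latter. *)
Lemma clam_pair i w : alternating (i :: labels w) ->
  exists y : V i, clam i (fp_word (Tagged V (t i) :: w)) =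
    d i *: fp_word w + fp_word (Tagged V y :: w).
Proof.
move=> alt; exists (- phi (P i) *: t i + (@S i (0, t i)).2).
have := fp_word_lin [::] (- phi (P i)) (t i) (@S i (0, t i)).2 w.
rewrite /= => ->; rewrite /clam /centered_op.
have -> : fp_word (Tagged V (t i) :: w) = concat_l ((0, t i) : pointed V i) w.
  by rewrite /concat_l /= scale0r add0r.
rewrite (lamP i).2 // /concat_l /= !scale0r !add0r scaleNr.
by rewrite [- _ + _]addrC addrA.
Qed.

Lemma clam_linear i : linear (clam i).
Proof. exact: modeled_linear (modeled_cP i). Qed.

Lemma st_centered_pair i : phi (cP i * cQ i) = phi (P i * Q i) - phi (P i) * phi (Q i).
Proof.
rewrite /cP /cQ /centered mulrBl !mulrBr -!scalerAl -!scalerAr !mulr1 !mul1r scalerA.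
by rewrite !stB !stZ st1; ring.
Qed.

Lemma pair_coef i : d i = phi (P i * Q i) - phi (P i) * phi (Q i).
Proof.
rewrite -st_centered_pair (modeled_st (modeledM (modeled_cP i) (modeled_cQ i))) /=.
rewrite /fp_vacuum crho_create //= .
have [y ->] := @clam_pair i [::] isT.
by rewrite vacuum_coef_linear !vacuum_coef_word /= addr0; apply/esym/mulr1.
Qed.

Lemma model_free_left b m k : (0 < m + k)%N ->
  phi (altr cP b m * altl cP (~~ b) k) = 0.
Proof.
move=> mk; rewrite (modeled_st (modeledM (modeled_altr _ _ modeled_cP) (modeled_altl _ _ modeled_cP))).
exact: (vac_alternating (@vacuum_coef_word C V) clam_create b mk).
Qed.

Lemma model_free_right b m k : (0 < m + k)%N ->
  phi (altr cQ b m * altl cQ (~~ b) k) = 0.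
Proof.
move=> mk; rewrite (modeled_st (modeledM (modeled_altr _ _ modeled_cQ) (modeled_altl _ _ modeled_cQ))).
apply: (@vac_alternating _ _ crho (fun w => fp_word (rev w)) t _ _ b m k mk) => [w|i w alt].
  by rewrite vacuum_coef_word; case: w => // l w; rewrite rev_cons; case: (rev w).
rewrite crho_create ?rev_cons // /labels map_rev -rev_cons alternating_rev.
exact: alt.
Qed.

Lemma model_bifree e m f k :
  phi (altr cP e m * altr cQ f k) =
  ((m == k) && ((e == f) || (m == 0%N)))%:R *
    altl (fun b => phi (P b * Q b) - phi (P b) * phi (Q b)) e m.
Proof.
rewrite (modeled_st (modeledM (modeled_altr _ _ modeled_cP) (modeled_altr _ _ modeled_cQ))).
rewrite /= (vac_altr_op_pair clam_linear clam_create clam_pair crho_create).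
by congr (_ * altl _ _ _); apply/funext => b; rewrite pair_coef.
Qed.

End BiFreeModel.

(** * Alternating projections in a Hilbert space *)

Section Hilbert.
Variables (R : realType) (H : hilbertSpace R).
Local Notation C := R[i].
Local Notation "''[' x , y ]" := (inner H x y).
Implicit Types (x y z : H) (T : H -> H).

Lemma innerDl x y z : '[x + y, z] = '[x, z] + '[y, z].
Proof. exact: linearDl. Qed.

Lemma innerBl x y z : '[x - y, z] = '[x, z] - '[y, z].
Proof. exact: linearBl. Qed.

Lemma innerZl (c : C) x z : '[c *: x, z] = c * '[x, z].
Proof. exact: linearZl_LR. Qed.

Lemma inner_conj x y : '[x, y] = Num.conj '[y, x].
Proof. by rewrite [LHS]hermC expr0 mul1r. Qed.

Lemma innerDr x y z : '[x, y + z] = '[x, y] + '[x, z].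
Proof. exact: linearDr. Qed.

Lemma innerBr x y z : '[x, y - z] = '[x, y] - '[x, z].
Proof. exact: linearBr. Qed.

Lemma innerZr (c : C) x z : '[x, c *: z] = Num.conj c * '[x, z].
Proof. exact: linearZr_LR. Qed.

Lemma inner_ge0 x : 0 <= '[x, x].
Proof. by rewrite -inner_norm exprn_ge0. Qed.

Lemma inner_eq0 x : '[x, x] = 0 -> x = 0.
Proof.
by rewrite -inner_norm => /eqP; rewrite sqrf_eq0 normr_eq0 => /eqP.
Qed.

Lemma inner_inj x y : (forall z, '[x, z] = '[y, z]) -> x = y.
Proof.
move=> h; apply/eqP; rewrite -subr_eq0; apply/eqP/inner_eq0.
by rewrite innerBl h subrr.
Qed.

Lemma CauchySchwarz x y : `|'[x, y]| <= `|x| * `|y|.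
Proof.
have [->|y0] := eqVneq y 0.
  by rewrite -[0](scale0r (0 : H)) innerZr conjC0 mul0r normr0 mulr_ge0.
have ny : 0 < `|y| ^+ 2 by rewrite exprn_gt0 // normr_gt0.
rewrite -(@ler_pXn2r _ 2) // ?nnegrE ?mulr_ge0 // exprMn.
have := inner_ge0 (`|y| ^+ 2 *: x - '[x, y] *: y).
rewrite innerBl !innerBr !innerZl !innerZr -!inner_norm (inner_conj y x).
rewrite (CrealP (ger0_real (ltW ny))) normCK.
set n := `|y| ^+ 2 in ny *; set c := '[x, y]; set m := `|x| ^+ 2.
have -> : n * (n * m) - n * (Num.conj c * c) - (c * (n * Num.conj c) - c * (Num.conj c * n))
   = n * (m * n - c * Num.conj c) by ring.
by rewrite pmulr_rge0 // subr_ge0.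
Qed.

Lemma cvg_inner (u : nat -> H) x z : u @ \oo --> x ->
  (fun n => '[u n, z] : C^o) @ \oo --> ('[x, z] : C^o).
Proof.
move=> /cvgrPdist_le ux; apply/cvgrPdist_le => e e0.
have z1 : 0 < `|z| + 1 by rewrite ltr_wpDl.
have := ux (e / (`|z| + 1)) (divr_gt0 e0 z1).
apply: filterS => n h; rewrite -innerBl (le_trans (CauchySchwarz _ _)) //.
rewrite ler_pdivlMr // in h; apply: le_trans h.
by rewrite ler_wpM2l // lerDl.
Qed.

Definition orthoproj T := [/\ linear T, self_adjoint T & T \o T = T].

Lemma orthoproj_idem T : orthoproj T -> forall x, T (T x) = T x.
Proof. by case=> _ _ TT x; rewrite -[in RHS]TT. Qed.

Lemma linear_sub T x y : linear T -> T (x - y) = T x - T y.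
Proof.
by move=> lT; have := lT (-1) y x; rewrite !scaleN1r ![- _ + _]addrC.
Qed.

Lemma orthoproj_inner T x : orthoproj T -> '[T x, x] = '[T x, T x].
Proof. by move=> hT; case: (hT) => _ sT _; rewrite [RHS]sT (orthoproj_idem hT) sT. Qed.

Lemma orthoproj_pythagoras T x : orthoproj T ->
  '[x, x] = '[T x, T x] + '[x - T x, x - T x].
Proof.
move=> hT; rewrite innerBl !innerBr; case: (hT) => _ sT _.
have h : '[x, T x] = '[T x, T x] by rewrite -sT orthoproj_inner.
by rewrite orthoproj_inner // h subrr subr0 addrC subrK.
Qed.

Lemma orthoproj_inner_le T x : orthoproj T -> '[T x, T x] <= '[x, x].
Proof. by move=> hT; rewrite (orthoproj_pythagoras x hT) lerDl inner_ge0. Qed.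

Lemma orthoproj_norm_le T x : orthoproj T -> `|T x| <= `|x|.
Proof.
move=> hT; rewrite -(@ler_pXn2r _ 2) ?nnegrE //.
by rewrite !inner_norm orthoproj_inner_le.
Qed.

Lemma orthoproj_fixed T x : orthoproj T -> '[x, x] <= '[T x, T x] -> T x = x.
Proof.
move=> hT; rewrite {1}(orthoproj_pythagoras x hT) gerDl => h.
apply/eqP; rewrite eq_sym -subr_eq0; apply/eqP/inner_eq0/eqP.
by rewrite eq_le h inner_ge0.
Qed.

Lemma orthoproj_continuous T : orthoproj T -> continuous T.
Proof.
move=> hT x; apply/cvgrPdist_le => e e0; near=> y.
case: (hT) => lT _ _; rewrite -linear_sub //; apply: le_trans (orthoproj_norm_le _ hT) _.
near: y; exact: cvgr_dist_le.
Unshelve. all: by end_near. Qed.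

Section AlternatingProjections.
Variables P Q : H -> H.
Hypothesis hP : orthoproj P.
Hypothesis hQ : orthoproj Q.

Definition compression : H -> H := P \o Q \o P.
Local Notation X := compression.

Let lP : linear P. Proof. by case: hP. Qed.
Let lQ : linear Q. Proof. by case: hQ. Qed.
Let sP : self_adjoint P. Proof. by case: hP. Qed.
Let sQ : self_adjoint Q. Proof. by case: hQ. Qed.
Let PP := orthoproj_idem hP.

Lemma compression_continuous : continuous X.
Proof.
have cP := orthoproj_continuous hP; have cQ := orthoproj_continuous hQ.
move=> x; apply: continuous_comp; first exact: cP.
by apply: continuous_comp; [exact: cQ | exact: cP].
Qed.

Lemma iter_linear n : linear (iter n X).
Proof. by elim: n => //= n IHn c x y; rewrite /= IHn /compression /= lP lQ lP. Qed.

Lemma iter_self_adjoint n : self_adjoint (iter n X).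
Proof.
elim: n => [//|n IHn] x y; rewrite iterSr IHn /=.
by rewrite /compression /= sP sQ sP.
Qed.

Lemma compression_inner x : '[X x, x] = '[Q (P x), Q (P x)].
Proof. by rewrite /compression /= sP orthoproj_inner. Qed.

Lemma iter_inner_double n x : '[iter n.*2 X x, x] = '[iter n X x, iter n X x].
Proof. by rewrite -addnn iterD iter_self_adjoint. Qed.

Lemma iter_inner_doubleS n x :
  '[iter n.*2.+1 X x, x] = '[X (iter n X x), iter n X x].
Proof. by rewrite -addnn -addnS iterD iter_self_adjoint. Qed.

Lemma iter_inner_ge0 n x : 0 <= '[iter n X x, x].
Proof.
rewrite -(odd_double_half n); case: (odd n).
  by rewrite iter_inner_doubleS compression_inner inner_ge0.
by rewrite iter_inner_double inner_ge0.
Qed.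

(** Even and odd powers interlace: they are squared norms of vectors obtained by
    applying [P] and [Q] in turn. *)
Lemma iter_inner_le n x : '[iter n.+1 X x, x] <= '[iter n X x, x].
Proof.
rewrite -(odd_double_half n); move: n./2 => k; case: (odd n).
  change (true + k.*2)%N with k.*2.+1.
  rewrite -doubleS iter_inner_double iter_inner_doubleS compression_inner.
  exact: (orthoproj_inner_le (Q (P (iter k X x))) hP).
change (false + k.*2)%N with k.*2.
rewrite iter_inner_double iter_inner_doubleS compression_inner.
by apply: le_trans (orthoproj_inner_le _ hQ) (orthoproj_inner_le _ hP).
Qed.

Lemma iter_dist n m x :
  '[iter n X x - iter m X x, iter n X x - iter m X x] =
  '[iter n.*2 X x, x] + '[iter m.*2 X x, x] - 2 * '[iter (n + m) X x, x].
Proof.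
rewrite innerBl !innerBr !iter_inner_double.
have h k l : '[iter k X x, iter l X x] = '[iter (k + l) X x, x].
  by rewrite addnC iterD [RHS]iter_self_adjoint.
by rewrite !h [(m + n)%N]addnC; ring.
Qed.

(** The squared distance of two iterates is a combination, of total weight 0, of
    values of the nonincreasing nonnegative sequence ['[iter n X x, x]]. *)
Lemma iter_cauchy x (e : R) : 0 < e -> exists N : nat, forall n m,
  (N <= n)%N -> (N <= m)%N -> `|iter n X x - iter m X x| <= e%:C.
Proof.
move=> e0; pose a n := complex.Re '[iter n X x, x].
have aE n : '[iter n X x, x] = (a n)%:C by rewrite RRe_real // ger0_real ?iter_inner_ge0.
have a0 n : 0 <= a n by rewrite -lecR -aE iter_inner_ge0.
have ami : nonincreasing_seq a.
  by apply/nonincreasing_seqP => n; rewrite -lecR -!aE iter_inner_le.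
have alb : has_lbound (range a) by exists 0 => _ [n _ <-].
have acv := nonincreasing_cvgn ami alb; set l := inf _ in acv.
have al n : l <= a n by apply: ge_inf => //; exists n.
have e2 : 0 < e ^+ 2 / 2 by rewrite divr_gt0 ?exprn_gt0.
have [N _ hN] := cvgr_lt _ acv (l + e ^+ 2 / 2) (ltr_pwDr e2 (lexx _)).
exists N => n m nN mN.
have leq_dbl k : (k <= k.*2)%N by rewrite -addnn leq_addr.
have e0c : 0 <= e%:C by rewrite (lecR 0) ltW.
rewrite -(@ler_pXn2r _ 2) ?nnegrE // inner_norm iter_dist !aE.
rewrite -(rmorphXn (real_complex R)) -(rmorph_nat (real_complex R)) -!rmorphM.
rewrite -rmorphD -rmorphB lecR.
have h1 := ltW (hN n.*2 (leq_trans nN (leq_dbl _))).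
have h2 := ltW (hN m.*2 (leq_trans mN (leq_dbl _))).
have h3 := al (n + m)%N.
lra.
Qed.

Lemma iter_cvg x : cvgn (fun n => iter n X x).
Proof.
apply/cauchy_cvgP/cauchy_exP => e e0.
have eE : e = (complex.Re e)%:C by rewrite RRe_real // gtr0_real.
have e20 : 0 < complex.Re e / 2 by rewrite divr_gt0 // -(ltcR 0) -eE.
have [N hN] := iter_cauchy x e20.
exists (iter N X x); exists N => // n /= Nn; rewrite -ball_normE /=.
apply: le_lt_trans (hN _ _ (leqnn N) Nn) _.
by rewrite [ltRHS]eE ltcR ltr_pdivrMr // ltr_pMr ?ltr1n // -(ltcR 0) -eE.
Qed.

Let range_fixed T y : orthoproj T -> range T y -> T y = y.
Proof. by move=> hT [z _ <-]; exact: orthoproj_idem. Qed.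

Lemma iter_fixed n z : P z = z -> Q z = z -> iter n X z = z.
Proof.
by move=> Pz Qz; elim: n => //= n ->; rewrite /compression /= Pz Qz Pz.
Qed.

Lemma meet_unique x y : P y = y -> Q y = y ->
  (forall z, P z = z -> Q z = z -> '[x - y, z] = 0) -> meet P Q x = y.
Proof.
move=> Py Qy xy; set E := range P `&` range Q.
have Ey : E y by split; [exists y | exists y].
have yE : E y /\ forall z, E z -> '[x - y, z] = 0.
  by split=> // z [Pz Qz]; apply: xy; exact: range_fixed.
have [[Pw Qw] xw] := xgetPex (0 : H)
  (ex_intro (fun y => E y /\ forall z, E z -> '[x - y, z] = 0) y yE).
set w := xget _ _ in Pw Qw xw; rewrite -[LHS]/w.
have fw := (range_fixed hP Pw, range_fixed hQ Qw).
apply/eqP; rewrite -subr_eq0; apply/eqP/inner_eq0.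
have h : P (w - y) = w - y by rewrite linear_sub // fw Py.
have h' : Q (w - y) = w - y by rewrite linear_sub // fw Qy.
have e1 := xy _ h h'.
have e2 : '[x - w, w - y] = 0 by apply: xw; split; [exists (w - y) | exists (w - y)].
have -> : '[w - y, w - y] = '[x - y, w - y] - '[x - w, w - y].
  by rewrite -innerBl; congr '[_, _]; rewrite opprB [in RHS]addrC subrKA.
by rewrite e1 e2 subr0.
Qed.

(** The limit [y] is fixed by [P Q]; as [Q] contracts, this leaves no room for
    [Q y] to be shorter than [y], so that [Q y = y]. *)
Lemma iter_limit x y : iter n X x @[n --> \oo] --> y ->
  [/\ P y = y, Q y = y & forall z, P z = z -> Q z = z -> '[x - y, z] = 0].
Proof.
move=> xy; have hausH := @norm_hausdorff _ H.
(* [iter 0 X x] need not lie in the range of [P]. *)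
have xyS : iter n.+1 X x @[n --> \oo] --> y by rewrite (cvg_shiftS (fun n => iter n X x)).
have Py : P y = y.
  apply: (cvg_unique hausH _ xyS).
  have -> : (fun n => iter n.+1 X x) = (fun n => P (iter n.+1 X x)).
    by apply/funext => n /=; rewrite /compression /= PP.
  apply: continuous_cvg xyS; exact: orthoproj_continuous.
have Xy : P (Q y) = y.
  rewrite -{1}Py; apply: (cvg_unique hausH _ xyS).
  exact: continuous_cvg (@compression_continuous y) xy.
have Qy : Q y = y.
  by apply: orthoproj_fixed hQ _; rewrite -{1 2}Xy orthoproj_inner_le.
split=> // z Pz Qz; rewrite innerBl; apply/eqP; rewrite subr_eq0; apply/eqP.
have c1 : (fun n => '[iter n X x, z] : C^o) @ \oo --> ('[x, z] : C^o).
  have -> : (fun n => '[iter n X x, z] : C^o) = (fun=> '[x, z]).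
    by apply/funext => n; rewrite iter_self_adjoint iter_fixed.
  exact: cvg_cst.
exact: (cvg_unique (@norm_hausdorff _ C^o) c1 (cvg_inner (z:=z) xy)).
Qed.

Lemma limit_meet x y : iter n X x @[n --> \oo] --> y -> meet P Q x = y.
Proof. by case/iter_limit; apply: meet_unique. Qed.

Lemma iter_cvg_meet x : iter n X x @[n --> \oo] --> meet P Q x.
Proof. by have /cvg_ex[y xy] := @iter_cvg x; rewrite (limit_meet xy). Qed.

Local Notation E := (meet P Q).

Lemma meet_linear : linear E.
Proof.
move=> c x y; apply: limit_meet.
have -> : (fun n => iter n X (c *: x + y)) = (fun n => c *: iter n X x + iter n X y).
  by apply/funext => n; rewrite iter_linear.
apply: cvgD (@iter_cvg_meet y); apply: cvgZr; exact: iter_cvg_meet.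
Qed.

Lemma meet_commute (T : H -> H) : continuous T ->
  (forall x, P (T x) = T (P x)) -> (forall x, Q (T x) = T (Q x)) ->
  forall x, E (T x) = T (E x).
Proof.
move=> cT PT QT x; apply: limit_meet.
have -> : (fun n => iter n X (T x)) = (fun n => T (iter n X x)).
  apply/funext; elim=> //= n ->.
  by rewrite /compression /= PT QT PT.
exact: continuous_cvg (@cT (E x)) (@iter_cvg_meet x).
Qed.

Lemma meet_spec x : [/\ P (E x) = E x, Q (E x) = E x &
  forall z, P z = z -> Q z = z -> '[x - E x, z] = 0].
Proof. exact: iter_limit (@iter_cvg_meet x). Qed.

Lemma meet_inner x y : '[E x, y] = '[E x, E y].
Proof.
have [Px Qx _] := meet_spec x; have [_ _ oy] := meet_spec y.
apply/eqP; rewrite -subr_eq0 -innerBr inner_conj oy ?conjC0 //.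
Qed.

Lemma meet_self_adjoint : self_adjoint E.
Proof. by move=> x y; rewrite meet_inner [RHS]inner_conj [in RHS]meet_inner -inner_conj. Qed.

Lemma meet_idem x : E (E x) = E x.
Proof.
have [Px Qx _] := meet_spec x.
by apply: meet_unique => // z _ _; rewrite subrr linear0l.
Qed.

Lemma meet_orthoproj : orthoproj E.
Proof.
by split; [exact: meet_linear | exact: meet_self_adjoint | apply/funext => x; exact: meet_idem].
Qed.

Lemma meet_continuous : continuous E.
Proof. exact: orthoproj_continuous meet_orthoproj. Qed.

Lemma meet_projl x : E (P x) = E x.
Proof.
apply: inner_inj => z; rewrite meet_self_adjoint sP.
by have [-> _ _] := meet_spec z; rewrite -meet_self_adjoint.
Qed.

Lemma meet_projr x : E (Q x) = E x.
Proof.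
apply: inner_inj => z; rewrite meet_self_adjoint sQ.
by have [_ -> _] := meet_spec z; rewrite -meet_self_adjoint.
Qed.

(** The difference of the two sides is the value of [iter n X], a positive operator,
    at [x - E x]. *)
Lemma meet_le_iter n x : '[E x, x] <= '[iter n X x, x].
Proof.
have [Px Qx _] := meet_spec x.
have := iter_inner_ge0 n (x - E x).
rewrite linear_sub; last exact: iter_linear.
rewrite (iter_fixed n Px Qx) innerBl !innerBr -meet_inner subrr subr0.
rewrite [X in _ - X](iter_self_adjoint n x) (iter_fixed n Px Qx).
by rewrite -meet_self_adjoint subr_ge0.
Qed.

Lemma wot_closed_meet (A : set (H -> H)) : wot_closed A ->
  (forall n, A (iter n X)) -> A E.
Proof.
move=> cA AX; apply: cA => [|m x y e e0].
  by split; [exact: meet_linear | exact: meet_continuous].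
have /= h (k : 'I_m) : \forall n \near \oo, `|'[E (x k), y k] - '[iter n X (x k), y k]| < e.
  have /cvgrPdist_lt := cvg_inner (z := y k) (@iter_cvg_meet (x k)); exact.
have [N _ hN] := filter_forall _ h.
by exists (iter N X) => [|k]; [exact: AX | rewrite innerBl; exact: (hN N (leqnn N) k)].
Qed.

End AlternatingProjections.



End Hilbert.

(** * A W*-probability space as an algebra with a state *)

Section OperatorAlgebra.
Variables (R : realType) (H : hilbertSpace R) (A : set (H -> H)) (phi : (H -> H) -> R[i]).
Hypothesis hA : wstar_probability_space A phi.

(** The hypothesis is an argument because the algebra structure of the elements of
    [A] depends on it and must be inferred from their type. *)
Definition in_walg (_ : wstar_probability_space A phi) : {pred (H -> H)} :=
  fun T => `[< A T >].

Let A_bounded T : A T -> bounded_op T. Proof. by case: hA => -[+ _ _ _ _] _ _; apply. Qed.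
Let A_id : A id. Proof. by case: hA => -[]. Qed.
Let A_lin c S T : A S -> A T -> A (c *: S + T).
Proof. by case: hA => -[_ _ [+ _] _ _] _ _; apply. Qed.
Let A_comp S T : A S -> A T -> A (S \o T).
Proof. by case: hA => -[_ _ [_ +] _ _] _ _; apply. Qed.
Let phi_lin c S T : A S -> A T -> phi (c *: S + T) = c * phi S + phi T.
Proof. by case: hA => _ [+ _ _] _; apply. Qed.
Let phi_id : phi id = 1. Proof. by case: hA => _ []. Qed.

Let A0 : A 0.
Proof. by have := A_lin (-1) A_id A_id; rewrite scaleN1r addNr. Qed.

Fact in_walg_submod : GRing.subsemimod_closed (in_walg hA).
Proof.
split; [split|] => [|S T|c S]; rewrite ?unfold_in.
- exact/asboolP.
- move=> /asboolP hS /asboolP hT; apply/asboolP.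
  by rewrite -[S]scale1r; apply: A_lin.
- move=> /asboolP hS; apply/asboolP.
  by rewrite -[_ *: _]addr0; apply: A_lin.
Qed.

HB.instance Definition _ :=
  GRing.isSubmodClosed.Build R[i] (H -> H) (in_walg hA) in_walg_submod.

Record walg := WAlg { wop :> H -> H; wop_in : wop \in in_walg hA }.
HB.instance Definition _ := [isSub for wop].
HB.instance Definition _ := [Choice of walg by <:].
HB.instance Definition _ := [SubChoice_isSubLmodule of walg by <:].

Lemma wopP (a : walg) : A (wop a). Proof. exact/asboolP/wop_in. Qed.

Definition of_A T (hT : A T) : walg := @WAlg T (introT (asboolP _) hT).

Definition walg_one : walg := of_A A_id.
Definition walg_mul (a b : walg) : walg := of_A (A_comp (wopP a) (wopP b)).

Lemma walg_mulA : associative walg_mul. Proof. by move=> a b c; apply: val_inj. Qed.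
Lemma walg_mul1 : left_id walg_one walg_mul. Proof. by move=> a; apply: val_inj. Qed.
Lemma walg_1mul : right_id walg_one walg_mul. Proof. by move=> a; apply: val_inj. Qed.
Lemma walg_mulDl : left_distributive walg_mul +%R.
Proof. by move=> a b c; apply: val_inj. Qed.

Lemma wop_linear (a : walg) : linear (wop a). Proof. by case: (A_bounded (wopP a)). Qed.

Lemma walg_mulDr : right_distributive walg_mul +%R.
Proof.
move=> a b c; apply: val_inj; apply/funext => x.
by have := wop_linear a 1 (wop b x) (wop c x); rewrite !scale1r.
Qed.
Lemma walg_one_neq0 : walg_one != 0.
Proof.
apply/eqP => /(congr1 wop) /= id0; have := phi_lin (-1) A_id A_id.
have -> : -1 *: id + id = id :> (H -> H) by rewrite scaleN1r addNr; exact: esym id0.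
by rewrite phi_id mulr1 addNr => /eqP; rewrite oner_eq0.
Qed.
HB.instance Definition _ := GRing.Zmodule_isNzRing.Build walg
  walg_mulA walg_mul1 walg_1mul walg_mulDl walg_mulDr walg_one_neq0.

Lemma walg_scalerAl (c : R[i]) (a b : walg) : c *: (a * b) = (c *: a) * b.
Proof. by apply: val_inj. Qed.
HB.instance Definition _ := GRing.Lmodule_isLalgebra.Build R[i] walg walg_scalerAl.
Lemma walg_scalerAr (c : R[i]) (a b : walg) : c *: (a * b) = a * (c *: b).
Proof.
apply: val_inj; apply/funext => x.
have a0 : wop a 0 = 0 by have := wop_linear a (-1) 0 0; rewrite !scaleN1r !addNr.
by have := wop_linear a c (wop b x) 0; rewrite a0 !addr0 => /esym.
Qed.
HB.instance Definition _ := GRing.Lalgebra_isAlgebra.Build R[i] walg walg_scalerAr.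

Definition walg_st (a : walg) : R[i] := phi (wop a).
Lemma walg_st_linear : scalar walg_st.
Proof. by move=> c a b; apply: phi_lin; exact: wopP. Qed.
HB.instance Definition _ := GRing.isLinear.Build R[i] walg R[i] *%R walg_st walg_st_linear.

Local Notation "''[' x , y ]" := (inner H x y).

Definition walg_adj (a b : walg) : Prop := is_adjoint (wop a) (wop b).

Lemma walg_adj_lin c a a' b b' : walg_adj a a' -> walg_adj b b' ->
  walg_adj (c *: a + b) (Num.conj c *: a' + b').
Proof.
move=> ha hb x y; rewrite -[LHS]/'[c *: wop a x + wop b x, y].
rewrite -[RHS]/'[x, Num.conj c *: wop a' y + wop b' y].
by rewrite innerDl innerZl innerDr innerZr conjCK ha hb.
Qed.

Lemma walg_adjM a a' b b' : walg_adj a a' -> walg_adj b b' ->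
  walg_adj (a * b) (b' * a').
Proof.
move=> ha hb x y; rewrite -[LHS]/'[wop a (wop b x), y] ha hb.
by [].
Qed.

Lemma walg_adj1 : walg_adj 1 1. Proof. by []. Qed.

Lemma walg_adj_sym a a' : walg_adj a a' -> walg_adj a' a.
Proof. by move=> ha x y; rewrite inner_conj -ha -inner_conj. Qed.

Lemma walg_st_ge0 a a' : walg_adj a a' -> 0 <= walg_st (a' * a).
Proof.
move=> ha; case: hA => _ [_ pos _] _; apply: pos; first exact: wopP.
move=> x; rewrite (linear0l (inner H)) -[X in _ <= X]/'[wop a' (wop a x), x].
by rewrite (walg_adj_sym ha) inner_ge0.
Qed.

Lemma walg_st1 : walg_st 1 = 1. Proof. exact: phi_id. Qed.

Definition walg_prob : starProb R[i] :=
  StarProb walg_adj_lin walg_adjM walg_adj1 walg_adj_sym walg_st_ge0 walg_st1.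

Lemma projection_orthoproj P : projection_in A P -> orthoproj P.
Proof. by case=> AP sP PP; split=> //; case: (A_bounded AP). Qed.

Section Meet.
Variables P Q : H -> H.
Hypotheses (hP : projection_in A P) (hQ : projection_in A Q).
Let oP := projection_orthoproj hP.
Let oQ := projection_orthoproj hQ.
Local Notation X := (compression P Q).

Lemma A_iter n : A (iter n X).
Proof.
case: (hP) (hQ) => AP _ _ [AQ _ _]; elim: n => [|n IHn]; first exact: A_id.
by apply: (A_comp (S := X)) => //; do 2!apply: A_comp => //.
Qed.

Lemma A_meet : A (meet P Q).
Proof. by apply: wot_closed_meet => //; [case: hA => -[] | exact: A_iter]. Qed.

(** Normality is about suprema, so it is applied to the operators [1 - X^(2m)], whose
    supremum is [1 - E]: an upper bound of these operators bounds their strong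
    limit. *)
Lemma normal_meet (c : R[i]) : (forall m, c <= phi (iter m.*2 X)) -> c <= phi (meet P Q).
Proof.
move=> hc; case: hA => vn st nor.
pose N (T : H -> H) : H -> H := (-1 : R[i]) *: T + id.
pose D := [set N (iter m.*2 X) | m in [set: nat]].
have phiN T : A T -> phi (N T) = 1 - phi T.
  by move=> AT; rewrite phi_lin // phi_id mulN1r addrC.
have AN T : A T -> A (N T) by move=> AT; exact: A_lin.
have NE T x : N T x = x - T x by rewrite -[LHS]/((-1) *: T x + x) scaleN1r addrC.
have saN T : self_adjoint T -> self_adjoint (N T).
  by move=> sT x y; rewrite !NE innerBl innerBr sT.
have inN T x : '[N T x, x] = '[x, x] - '[T x, x] by rewrite NE innerBl.
have mono m n x : (m <= n)%N -> '[iter n X x, x] <= '[iter m X x, x].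
  move=> /subnK <-; elim: (n - m)%N => // k IHk.
  by apply: le_trans IHk; rewrite addSn iter_inner_le.
have supD : op_sup A D (N (meet P Q)).
  split; [exact/AN/A_meet | exact/saN/meet_self_adjoint | |].
    by move=> _ [m _ <-] x; rewrite !inN lerD2l lerN2 meet_le_iter.
  move=> U AU sU hU x; rewrite inN.
  have hUm m : 0 <= '[U x, x] - '[x, x] + '[iter m.*2 X x, x].
    have := hU _ (ex_intro2 _ _ m I erefl) x.
    by rewrite inN lerBlDr -subr_ge0 addrAC.
  rewrite lerBlDr -subr_ge0 addrAC; set t := _ + _.
  have t_real : t \is Num.real.
    have -> : t = ('[U x, x] - '[x, x] + '[iter 0 X x, x]) - '[x, x] + '[meet P Q x, x].
      by rewrite /= subrK.
    rewrite rpredD ?rpredB ?ger0_real ?inner_ge0 ?(hUm 0%N) //.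
    by rewrite orthoproj_inner ?inner_ge0 //; exact: meet_orthoproj.
  (* If [t < 0], some iterate is within [- t] of the limit, against [hUm]. *)
  rewrite real_leNgt ?real0 //; apply/negP => t0.
  have := cvg_inner (z := x) (@iter_cvg_meet _ _ _ _ oP oQ x).
  move=> /cvgrPdist_lt /(_ (- t)); rewrite oppr_gt0 => /(_ t0) [n _ hn].
  have nn : (n <= n.*2)%N by rewrite -addnn leq_addr.
  have := hn _ nn; rewrite /= distrC ger0_norm ?subr_ge0 ?meet_le_iter //.
  rewrite ltrBlDr addrC -subr_gt0 => h.
  have tE : '[meet P Q x, x] - t - '[iter n.*2 X x, x] =
      - ('[U x, x] - '[x, x] + '[iter n.*2 X x, x]) by rewrite /t; ring.
  by rewrite tE oppr_gt0 in h; have := hUm n; rewrite (lt_geF h).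
have dirD : directed D.
  split; first by exists (N (iter 0 X)); exists 0%N.
  move=> _ _ [m _ <-] [n _ <-]; exists (N (iter (maxn m n).*2 X)).
    by exists (maxn m n).
  by split=> x; rewrite !inN lerD2l lerN2 mono // leq_double ?leq_maxl ?leq_maxr.
have DA : D `<=` A by move=> _ [m _ <-]; exact/AN/A_iter.
have Dsa : D `<=` @self_adjoint R H.
  by move=> _ [m _ <-]; exact/saN/iter_self_adjoint.
have [_ lub] := nor D _ DA Dsa dirD supD.
have : phi (N (meet P Q)) <= 1 - c.
  apply: lub => _ [_ [m _ <-] <-]; rewrite phiN ?lerD2l ?lerN2 ?hc //; exact: A_iter.
by rewrite phiN ?lerD2l ?lerN2 //; exact: A_meet.
Qed.

End Meet.

End OperatorAlgebra.

(** * Bi-free projections *)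

Section Transfer.
Variables (R : realType) (H : hilbertSpace R) (A : set (H -> H)) (phi : (H -> H) -> R[i]).
Hypothesis hA : wstar_probability_space A phi.
Local Notation B := (walg_prob hA).

Lemma A_projection T : projection_in A T -> A T. Proof. by case. Qed.

Definition walg_proj (P : bool -> H -> H) (hP : forall b, projection_in A (P b)) b : B :=
  of_A hA (A_projection (hP b)).

Lemma st_walg_proj_real P hP b :
  st B (@walg_proj P hP b) = (complex.Re (phi (P b)))%:C.
Proof.
rewrite RRe_real // -[phi (P b)]/(st B (walg_proj hP b)).
by apply: st_sa_real; case: (hP b).
Qed.

Lemma walg_free_meet P (hP : forall b, projection_in A (P b)) :
  (forall b m k, (0 < m + k)%N ->
    st B (altr (centered (walg_proj hP)) b m *
          altl (centered (walg_proj hP)) (~~ b) k) = 0) ->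
  free_meet (walg_proj hP) (fun b => complex.Re (phi (P b)))
    (of_A hA (A_meet hA (hP true) (hP false)) : B).
Proof.
have oP b : orthoproj (P b) := projection_orthoproj hA (hP b).
have spec := meet_spec (oP true) (oP false).
move=> free; split.
- by move=> b; case: (hP b).
- by move=> b; apply: val_inj; case: (hP b).
- exact: st_walg_proj_real.
- exact: free.
- exact: meet_self_adjoint (oP true) (oP false).
- apply: val_inj; apply/funext => x; exact: meet_idem (oP true) (oP false) x.
- by move=> b; apply: val_inj; apply/funext => x /=; case: (spec x); case: b.
- move=> b; apply: val_inj; apply/funext => x /=.
  case: b; first exact: (meet_projl (oP true) (oP false) x).
  exact: (meet_projr (oP true) (oP false) x).
- move=> c hc; apply: (normal_meet hA (hP true) (hP false)) => m.
  apply: le_trans (hc m) _; rewrite -exprD addnn.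
  set X : B := _ * _; rewrite -[leLHS]/(phi (wop (X ^+ m.*2))).
  suff -> : wop (X ^+ m.*2) = iter m.*2 (compression (P true) (P false)) by [].
  elim: m.*2 => [//|n IHn]; rewrite exprS.
  by rewrite -[LHS]/(wop X \o wop (X ^+ n)) IHn; apply/funext.
Qed.

End Transfer.

Theorem theorem2p1 (R : realType) (H : hilbertSpace R)
    (A : set (H -> H)) (phi : (H -> H) -> R[i])
    (hA : wstar_probability_space A phi)
    (P Q P' Q' : H -> H)
    (hP : projection_in A P) (hQ : projection_in A Q)
    (hP' : projection_in A P') (hQ' : projection_in A Q')
    (hPQ : P \o Q = Q \o P) (hP'Q : P' \o Q = Q \o P')
    (hPQ' : P \o Q' = Q' \o P) (hP'Q' : P' \o Q' = Q' \o P')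
    (hfree : bi_free phi (P, Q) (P', Q')) :
  [/\ phi (meet P P') = Num.max (phi P + phi P' - 1) 0,
      phi (meet Q Q') = Num.max (phi Q + phi Q' - 1) 0,
      0 < phi (meet P P') -> 0 < phi (meet Q Q') ->
      0 < phi (P \o Q) -> 0 < phi (P' \o Q') ->
        phi (meet P P' \o meet Q Q') != 0 /\
        phi (meet P P') * phi (meet Q Q') / phi (meet P P' \o meet Q Q') =
        phi P * phi Q / phi (P \o Q) + phi P' * phi Q' / phi (P' \o Q') - 1 &
      [\/ phi (meet P P') = 0, phi (meet Q Q') = 0,
          phi (P \o Q) = 0 | phi (P' \o Q') = 0] ->
        phi (meet P P' \o meet Q Q') = 0].
Proof.
pose B := walg_prob hA.
pose Pf b := if b then P else P'; pose Qf b := if b then Q else Q'.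
have hPf b : projection_in A (Pf b) by case: b.
have hQf b : projection_in A (Qf b) by case: b.
have oPf b : orthoproj (Pf b) := projection_orthoproj hA (hPf b).
have oQf b : orthoproj (Qf b) := projection_orthoproj hA (hQf b).
have PQ_com b e x : Pf b (Qf e x) = Qf e (Pf b x).
  by move: b e => [] [] /=;
     [move: hPQ|move: hPQ'|move: hP'Q|move: hP'Q'] => /(congr1 (fun f => f x)).
pose Pw := walg_proj hA hPf : bool -> B; pose Qw := walg_proj hA hQf : bool -> B.
have [V [S [T [S_lin T_lin model]]]] := hfree.
have modelB s : st B (sp_monomial Pw Qw s) =
    vacuum_state (monomial (fun i => (lambda_op (@S i), rho_op (@T i))) s).
  rewrite -model -[LHS]/(phi (wop (sp_monomial Pw Qw s))); congr phi.
  by elim: s => // -[b e] s /= <-; case: b e => [] [].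
have PE := walg_free_meet (@model_free_left _ B V S T S_lin T_lin Pw Qw modelB).
have QF := walg_free_meet (@model_free_right _ B V S T S_lin T_lin Pw Qw modelB).
set E : B := of_A _ _ in PE; set F : B := of_A _ _ in QF.
have EQ x e : meet P P' (Qf e x) = Qf e (meet P P' x).
  apply: (meet_commute (oPf true) (oPf false)) => [|y|y].
  - exact: orthoproj_continuous.
  - exact: PQ_com true e y.
  - exact: PQ_com false e y.
have EF x : meet P P' (meet Q Q' x) = meet Q Q' (meet P P' x).
  apply/esym/(meet_commute (oQf true) (oQf false)) => [|y|y].
  - exact: meet_continuous (oPf true) (oPf false).
  - by rewrite -(EQ y true).
  - by rewrite -(EQ y false).
pose r b := complex.Re (phi (Pf b \o Qf b)).
have PQw_com b : Pw b * Qw b = Qw b * Pw b.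
  by apply: val_inj; apply/funext => x; exact: PQ_com.
have PQ_st b : st B (Pw b * Qw b) = (r b)%:C.
  rewrite RRe_real // -[phi _]/(st B (Pw b * Qw b)); apply: st_sa_real.
  by rewrite {2}PQw_com; apply: adjM; [case: (hPf b)|case: (hQf b)].
pose p b := complex.Re (phi (Pf b)); pose q b := complex.Re (phi (Qf b)).
have P_st b : phi (Pf b) = (p b)%:C := fm_st PE b.
have Q_st b : phi (Qf b) = (q b)%:C := fm_st QF b.
have bif := model_bifree S_lin T_lin modelB.
have EQw b : E * Qw b = Qw b * E.
  by apply: val_inj; apply/funext => x; exact: EQ.
have EFw : E * F = F * E by apply: val_inj; apply/funext => x; exact: EF.
have maxC (x : R) : (Num.max x 0)%:C = Num.max x%:C 0.
  by rewrite /Num.max /Order.max -[0 in RHS]/(0%:C) ltcR; case: ifP.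
have stE : phi (meet P P') = Num.max (phi P + phi P' - 1) 0.
  rewrite [phi P](P_st true) [phi P'](P_st false) -rmorphD.
  rewrite -(rmorph1 (real_complex R)) -rmorphB -maxC; exact: meet_value PE.
have stF : phi (meet Q Q') = Num.max (phi Q + phi Q' - 1) 0.
  rewrite [phi Q](Q_st true) [phi Q'](Q_st false) -rmorphD.
  rewrite -(rmorph1 (real_complex R)) -rmorphB -maxC; exact: meet_value QF.
split=> // [E0 F0 PQ0 PQ0'|].
  have PQpos b : 0 < st B (Pw b * Qw b) by case: b.
  exact: (st_meets_value PE QF PQ_st bif EFw E0 F0 PQpos).
case=> [E0|F0|PQ0|PQ0]; rewrite -[LHS]/(st B (E * F)).
- exact: (st_meets_eq0l PE QF E0).
- exact: (st_meets_eq0r PE QF F0).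
- exact: (st_meets_eq0 PE QF PQw_com EQw EFw (b := true) PQ0).
- exact: (st_meets_eq0 PE QF PQw_com EQw EFw (b := false) PQ0).
Qed.
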